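(* Let $\Delta$ be a smooth closed polytope in $\mathbb R^n$. (i) If $\Delta$ is compact and $2$-dimensional, the set of points in $\Delta$ with nontrivial qW invariants is the union of a finite number of points with at most one line segment. (ii) In any dimension, adding ghost facets to the potential does not change the set of points $u\in\mathrm{Int}\,\Delta$ such that $W_{u,\alpha}$ has a critical point for some $\alpha\in\Lambda_0^N$.
   Context: A smooth closed polytope is a finite intersection of closed half-spaces $\Delta=\{x\in\mathbb R^n:\ell_i(x)=\langle\eta_i,x\rangle+\kappa_i\ge0\}$ with facet conormals $\eta_i\in\mathbb Z^n$ primitive, such that each codimension-$k$ face meets exactly $k$ facets and their conormals extend to a basis of $\mathbb Z^n$. A presentation of $\Delta$ is $\Delta=\{x:\ell_i(x)=\langle\eta_i,x\rangle+\kappa_i\ge0,\ i=1,\dots,N\}$ with $\eta_i\in\mathbb Z^n$, $\kappa_i\in\mathbb R$, containing the inequalities of the actual facets and possibly finitely many further inequalities called ghost facets: $\ell_i\geq 0$ is a ghost facet if $\ell_i(x)>0$ for all $x\in\Delta\setminus f$, where $f$ is a (possibly empty) face of dimension less than $n-1$. The geometric presentation has no ghost facets. Let $\Lambda$ be the field of series $\sum_{d\in\mathbb R}a_dq^d$, $a_d\in\mathbb C$, with $\{d:a_d\neq0\}\subset\mathbb R$ discrete and bounded below, with valuation $\nu(\sum a_dq^d)=\min\{d:a_d\ne0\}$, $\nu(0)=\infty$, and $\Lambda_0=\{\nu\ge0\}$; $\exp:\Lambda_0\to\Lambda_0$ is defined by the power series. Given a presentation, $x\in\mathrm{Int}\,\Delta$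 and $\alpha\in\Lambda_0^N$, the potential is $$W_{x,\alpha}:\Lambda_0^n\to\Lambda_0,\qquad W_{x,\alpha}(\beta)=\sum_{i=1}^N\exp(\langle\eta_i,\beta\rangle+\alpha_i)\,q^{\ell_i(x)},$$ and a critical point is $\beta\in\Lambda_0^n$ with $\partial_{\beta_j}W_{x,\alpha}(\beta)=0$ for all $j$. The point $x$ has nontrivial (nonzero) qW invariants if $W_{x,\alpha}$ has a critical point for some presentation of $\Delta$ (possibly with ghost facets) and some $\alpha\in\Lambda_0^N$. In (ii), $N$ is the number of inequalities in the presentation used. *)

(* Defs.v *)
From HB Require Import structures.
From mathcomp Require Import all_boot all_order all_algebra.
From mathcomp Require Import finmap complex ring lra.
From mathcomp Require Import all_classical all_reals ereal topology normedtype sequences.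

Set Implicit Arguments.
Unset Strict Implicit.
Unset Printing Implicit Defensive.

Import Order.TTheory GRing.Theory Num.Theory numFieldNormedType.Exports.
Local Open Scope classical_set_scope.
Local Open Scope ring_scope.

Section NovikovDef.
Variable R : realType.

Definition series_supp (f : R -> R[i]) : set R := [set d | f d != 0].

(* f d is the coefficient a_d of q^d.  "Discrete" is read as "closed and
   discrete in the real line", i.e. locally finite: if the support could
   accumulate, products of series would involve infinite sums. *)
Definition novikov_series (f : R -> R[i]) : Prop :=
  has_lbound (series_supp f) /\
  forall a b : R, finite_set (series_supp f `&` [set d | a <= d <= b]).

Definition novikov_pred : {pred R -> R[i]} := [pred f | `[< novikov_series f >]].

(* The field Lambda.  Only its commutative ring structure is built, since no
   division occurs below. *)
Record novikov := Novikov { coef :> R -> R[i] ; _ : coef \in novikov_pred }.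

HB.instance Definition _ := [isSub for coef].
HB.instance Definition _ := [Choice of novikov by <:].

Lemma novikovP (f : R -> R[i]) :
  novikov_series f <->
  has_lbound (series_supp f) /\
  forall b, finite_set (series_supp f `&` [set d | d <= b]).
Proof.
split=> -[[l lf] fin]; split; try by exists l.
  move=> b; apply: sub_finite_set (fin l b) => d [/= fd db].
  by split=> //=; rewrite db andbT; apply: lf.
move=> a b; apply: sub_finite_set (fin b) => d [/= fd /andP[_ db]].
by split.
Qed.

Lemma novikov_closed : zmod_closed novikov_pred.
Proof.
split.
  apply/asboolP/novikovP; split; first by exists 0 => d /=; rewrite /series_supp /= eqxx.
  by move=> b; apply: (sub_finite_set _ (finite_set0 R)) => d [/eqP].
move=> f g /asboolP/novikovP[[l lf] finf] /asboolP/novikovP[[m mg] fing].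
have sub : series_supp (f - g) `<=` series_supp f `|` series_supp g.
  move=> d; rewrite /series_supp /= => fg0.
  have [f0|] := eqVneq (f d) 0; last by left.
  right; apply: contra_neq fg0 => g0.
  by rewrite /GRing.add /GRing.opp /= f0 g0 subrr.
apply/asboolP/novikovP; split.
  exists (Num.min l m) => d /sub[] /= h; rewrite ge_min; apply/orP.
    by left; apply: lf.
  by right; apply: mg.
move=> b; have : finite_set ((series_supp f `&` [set d | d <= b]) `|`
   (series_supp g `&` [set d | d <= b])) by rewrite finite_setU.
by apply: sub_finite_set => d [/sub[] /= ? ?]; [left|right].
Qed.

HB.instance Definition _ := GRing.isZmodClosed.Build _ novikov_pred novikov_closed.
HB.instance Definition _ := [SubChoice_isSubZmodule of novikov by <:].

Lemma coefP (x : novikov) : novikov_series x.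
Proof. by case: x => f /= /asboolP. Qed.

Lemma coef_lbound (x : novikov) : exists l, forall d, x d != 0 -> l <= d.
Proof. by have [[l lx] _] := coefP x; exists l => d; apply: lx. Qed.

Lemma coef_fin (x : novikov) b : finite_set [set d | x d != 0 /\ d <= b].
Proof. by have /novikovP[_ /(_ b)] := coefP x. Qed.

Lemma novikov_eqP (x y : novikov) : (forall d, x d = y d) -> x = y.
Proof. by move=> xy; apply: val_inj; apply/funext. Qed.

Lemma coefD (x y : novikov) d : (x + y) d = x d + y d.
Proof. by []. Qed.

Lemma coef0 d : (0 : novikov) d = 0. Proof. by []. Qed.

Definition qpow_fun (e : R) : R -> R[i] := fun d => (d == e)%:R.

Lemma qpow_subproof e : qpow_fun e \in novikov_pred.
Proof.
have sub : series_supp (qpow_fun e) `<=` [set e].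
  by move=> d; rewrite /series_supp /qpow_fun /=; case: (eqVneq d e) => // _ /eqP.
apply/asboolP/novikovP; split; first by exists e => d /sub ->.
by move=> b; apply: sub_finite_set (finite_set1 e) => d [/sub].
Qed.

Definition qpow e : novikov := Novikov (qpow_subproof e).

(* For Novikov series only finitely many terms are nonzero. *)
Definition cauchy_fun (f g : R -> R[i]) : R -> R[i] :=
  fun d => \sum_(e \in [set: R]) f e * g (d - e).

Lemma cauchy_neq0 (f g : R -> R[i]) d : cauchy_fun f g d != 0 ->
  exists e, f e != 0 /\ g (d - e) != 0.
Proof.
move=> fg0; apply: contrapT => h; move/eqP: fg0; apply.
apply: fsbig1 => e _; have [->|fe] := eqVneq (f e) 0; first by rewrite mul0r.
have [->|ge] := eqVneq (g (d - e)) 0; first by rewrite mulr0.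
by case: h; exists e.
Qed.

Lemma cauchy_subproof (x y : novikov) : cauchy_fun x y \in novikov_pred.
Proof.
have [l lx] := coef_lbound x; have [m my] := coef_lbound y.
apply/asboolP/novikovP; split.
  exists (l + m) => d /cauchy_neq0[e [/lx le /my]].
  by rewrite lerBrDr addrC; apply: le_trans; rewrite lerD2r.
move=> b.
have := finite_image2 (@GRing.add R) (coef_fin x (b - m)) (coef_fin y (b - l)).
apply: sub_finite_set => d [/cauchy_neq0[e [xe ye]] /= db].
exists e => /=.
  by split=> //; rewrite lerBrDr -lerBrDl (le_trans (my _ ye))// lerB.
by exists (d - e); [split=> //; rewrite lerB// lx | rewrite addrC subrK].
Qed.

Definition novikov_mul (x y : novikov) : novikov := Novikov (cauchy_subproof x y).

Lemma sum_addrr (F : R -> R[i]) (c : R) :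
  \sum_(e \in [set: R]) F e = \sum_(e \in [set: R]) F (e + c).
Proof.
apply: reindex_fsbigT; exists (fun e => e - c) => e; [exact: addrK|exact: subrK].
Qed.

Lemma novikov_mulC : commutative novikov_mul.
Proof.
move=> x y; apply: novikov_eqP => d /=; rewrite /cauchy_fun.
rewrite (reindex_fsbigT (fun e => d - e)); last first.
  by exists (fun e => d - e) => e; rewrite opprB addrC subrK.
by apply: eq_fsbigr => e _; rewrite mulrC opprB (addrC d) subrK.
Qed.

Lemma cauchy_finite (x y : novikov) d :
  finite_set [set e | x e * y (d - e) != 0].
Proof.
have [m my] := coef_lbound y.
apply: sub_finite_set (coef_fin x (d - m)) => e /=.
rewrite mulf_eq0 negb_or => /andP[-> /my]; split=> //.
by rewrite lerBrDr addrC -lerBrDr.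
Qed.

Lemma novikov_mulDl : left_distributive novikov_mul +%R.
Proof.
move=> x y z; apply: novikov_eqP => d.
rewrite coefD /= /cauchy_fun.
pose A := [set e | x e * z (d - e) != 0] `|` [set e | y e * z (d - e) != 0].
have finA : finite_set A by rewrite finite_setU; split; apply: cauchy_finite.
have wid (F : R -> R[i]) : (forall e, ~ A e -> F e = 0) ->
   \sum_(e \in [set: R]) F e = \sum_(e \in A) F e.
  by move=> F0; apply/esym/fsbig_widen => // e [_ /F0].
rewrite !wid -?fsbig_split//.
- by apply: eq_fsbigr => e _; exact: mulrDl.
- by move=> e /not_orP[_]; move=> /negP/negPn/eqP.
- by move=> e /not_orP[+ _]; move=> /negP/negPn/eqP.
- move=> e /not_orP[/negP/negPn/eqP + /negP/negPn/eqP].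
  by move=> xz yz; rewrite -[LHS]/((x e + y e) * z (d - e)) mulrDl xz yz addr0.
Qed.

Lemma novikov_mul1 : left_id (qpow 0) novikov_mul.
Proof.
move=> x; apply: novikov_eqP => d /=; rewrite /cauchy_fun.
rewrite -(fsbig_widen [set 0])//.
  by rewrite fsbig_set1 /qpow_fun eqxx mul1r subr0.
by move=> e [_ /= /eqP/negPf e0]; rewrite /qpow_fun e0 mul0r.
Qed.

Lemma novikov_mulA : associative novikov_mul.
Proof.
move=> x y z; apply: novikov_eqP => d /=; rewrite {1 3}/cauchy_fun /=.
have [l lx] := coef_lbound x; have [m my] := coef_lbound y.
have [k kz] := coef_lbound z.
pose A := [set e | x e != 0 /\ e <= d - m - k].
pose B := [set e | z (d - e) != 0 /\ (d - e) <= d - l - m].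
have finA : finite_set A by exact: coef_fin.
have finB : finite_set B.
  apply: sub_finite_set (finite_image (fun e => d - e) (coef_fin z (d - l - m))).
  by move=> e Be; exists (d - e) => //; rewrite opprB addrC subrK.
have NA u : ~ A u -> x u = 0 \/ d - m - k < u.
  by move=> /not_andP[/negP/negPn/eqP|/negP]; [left|rewrite -ltNge; right].
have NB u : ~ B u -> z (d - u) = 0 \/ u < l + m.
  move=> /not_andP[/negP/negPn/eqP|/negP]; [by left|rewrite -ltNge => h; right].
  by lra.
transitivity (\sum_(u \in A) \sum_(e \in B) x u * y (e - u) * z (d - e)).
  rewrite -(fsbig_widen A)//; last first.
    move=> u [_ /NA[xu|lu]] /=; first by rewrite xu mul0r.
    rewrite [X in _ * X]fsbig1 ?mulr0// => e _.
    have [->|/my me] := eqVneq (y e) 0; first by rewrite mul0r.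
    have [->|/kz] := eqVneq (z (d - u - e)) 0; first by rewrite mulr0.
    by move=> kd; exfalso; lra.
  apply: eq_fsbigr => u _.
  rewrite mulr_fsumr (sum_addrr _ (- u)) -(fsbig_widen B)//; last first.
    move=> e [_ /NB[ze|lm]] /=.
      by rewrite opprB addrA subrK ze !mulr0.
    have [->|/lx lu] := eqVneq (x u) 0; first by rewrite mul0r.
    have [->|/my me] := eqVneq (y (e - u)) 0; first by rewrite mul0r mulr0.
    by exfalso; lra.
  apply: eq_fsbigr => e _.
  by rewrite mulrA opprB addrA subrK.
rewrite exchange_fsbig//.
rewrite -[RHS](fsbig_widen B)//; last first.
  move=> e [_ /NB[ze|lm]] /=; first by rewrite ze mulr0.
  rewrite /cauchy_fun fsbig1 ?mul0r// => u _.
  have [->|/lx lu] := eqVneq (x u) 0; first by rewrite mul0r.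
  have [->|/my me] := eqVneq (y (e - u)) 0; first by rewrite mulr0.
  by exfalso; lra.
apply: eq_fsbigr => e _.
rewrite /cauchy_fun mulr_fsuml -[RHS](fsbig_widen A)//.
move=> u [_ /NA[xu|lu]] /=; first by rewrite xu !mul0r.
have [->|/my me] := eqVneq (y (e - u)) 0; first by rewrite mulr0 mul0r.
have [->|/kz ke] := eqVneq (z (d - e)) 0; first by rewrite mulr0.
by exfalso; lra.
Qed.


Lemma novikov_1neq0 : qpow 0 != 0.
Proof.
apply/eqP => /(congr1 (fun x => coef x 0)); rewrite coef0 /= /qpow_fun eqxx.
exact/eqP/oner_neq0.
Qed.

HB.instance Definition _ := GRing.Zmodule_isComNzRing.Build novikov
  novikov_mulA novikov_mulC novikov_mul1 novikov_mulDl novikov_1neq0.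

Local Open Scope ereal_scope.

(* The infimum is a minimum for x != 0, and +oo for x = 0. *)
Definition valuation (x : novikov) : \bar R :=
  ereal_inf [set d%:E | d in series_supp x].

Lemma valuation_ge0P (x : novikov) :
  0 <= valuation x <-> forall d, x d != 0%R -> (0 <= d)%R.
Proof.
split=> [vx d xd|x0].
  by rewrite -lee_fin; apply: le_trans vx _; apply: ereal_inf_lbound; exists d.
by apply: le_ereal_inf_tmp => _ [d /x0 d0 <-]; rewrite lee_fin.
Qed.

Local Close Scope ereal_scope.

(* The coefficients of \sum_k x^k / k!.  If x has a constant term this series
   does not converge for the valuation, hence the coefficientwise limit, for
   the usual topology on the complex numbers. *)
Definition exp_fun (x : novikov) : R -> R[i] := fun d =>
  limn (fun m => (\sum_(k < m) (x ^+ k) d / k`!%:R : (R[i])^o)).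

Lemma expr_supp (x : novikov) (b : R) : (0 <= valuation x)%E ->
  exists2 B : set R, finite_set B &
    forall k d, (x ^+ k) d != 0 -> 0 <= d /\ (d <= b -> B d).
Proof.
move=> /valuation_ge0P x0.
pose A := [set d | x d != 0 /\ d <= b] `&` [set d | 0 < d].
have finA : finite_set A by apply: finite_setIl; apply: coef_fin.
have [e e0 eA] : exists2 e : R, 0 < e & forall d, A d -> e <= d.
  exists (\big[Num.min/1]_(d <- fset_set A) d).
    rewrite big_seq; apply: (big_ind (fun c => 0 < c)) => //.
      by move=> u v u0 v0; rewrite lt_min u0.
    by move=> d; rewrite in_fset_set// inE => -[].
  by move=> d Ad; apply: (@ge_bigmin_seq _ _ _ _ _ d xpredT id) => //; rewrite in_fset_set ?inE.
pose fix P (m : nat) : set R :=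
  if m is m'.+1 then [set u + v | u in A & v in P m'] else [set 0].
have finP m : finite_set (P m).
  by elim: m => [|m IH] /=; [exact: finite_set1|exact: finite_image2].
have leP m d : P m d -> m%:R * e <= d.
  elim: m d => [|m IH] d /=; first by move->; rewrite mul0r.
  move=> [u Au [v Pv <-]]; rewrite -natr1 mulrDl mul1r addrC.
  by apply: lerD; [exact: eA|exact: IH].
pose M := (Num.truncn (b / e)).+1.
exists (\bigcup_(m in `I_M) P m).
  by apply: bigcup_finite => // m _; exact: finP.
have step k d : (x ^+ k) d != 0 -> 0 <= d /\ (d <= b -> exists m, P m d).
  elim: k d => [|k IH] d.
    rewrite expr0 /= /qpow_fun; have [->|_] := eqVneq d 0; last by rewrite eqxx.
    by move=> _; split=> // _; exists 0%N.
  rewrite exprS => /cauchy_neq0[u [xu xk]].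
  have u0 := x0 _ xu; have [v0 Pv] := IH _ xk.
  split=> [|db]; first by rewrite -(subrK u d) addr_ge0.
  have [m Pm] : exists m, P m (d - u) by apply: Pv; lra.
  have [u00|un0] := eqVneq u 0; first by exists m; rewrite -(subr0 d) -u00.
  exists m.+1; exists u; last by exists (d - u) => //; rewrite addrC subrK.
  by split=> /=; [split=> //; lra|rewrite lt_neqAle eq_sym un0].
move=> k d /step[d0 Pd]; split=> // db; have [m Pm] := Pd db.
exists m => //=; rewrite /M ltnS.
have b0 : 0 <= b by exact: le_trans db.
rewrite truncn_ge_nat ?divr_ge0 ?(ltW e0)//.
by rewrite ler_pdivlMr//; apply: le_trans db; apply: leP.
Qed.

Lemma exp_fun_eq0 (x : novikov) d :
  (forall k, (x ^+ k) d = 0) -> exp_fun x d = 0.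
Proof.
move=> xd; rewrite /exp_fun (_ : (fun m => _) = (fun=> 0 : (R[i])^o)).
  apply: (@lim_cst (R[i])^o); exact: norm_hausdorff.
by apply/funext => m; rewrite big1// => k _; rewrite xd mul0r.
Qed.

Lemma exp_subproof (x : novikov) : (0 <= valuation x)%E ->
  exp_fun x \in novikov_pred.
Proof.
move=> x0; have expE d : (forall k, (x ^+ k) d = 0) -> exp_fun x d = 0.
  exact: exp_fun_eq0.
have supp d : exp_fun x d != 0 -> exists k, (x ^+ k) d != 0.
  move=> xd; apply: contrapT => h; move/eqP: xd; apply; apply: expE => k.
  by apply/eqP/negPn/negP => xk; apply: h; exists k.
apply/asboolP/novikovP; split.
  exists 0 => d /supp[k xk]; have [B _ BP] := expr_supp 0 x0.
  by have [] := BP _ _ xk.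
move=> b; have [B finB BP] := expr_supp b x0.
by apply: sub_finite_set finB => d [/supp[k /BP[_ Bd]]] /=.
Qed.

(* Junk value 0 when exp_fun x is not a Novikov series; this does not happen
   for x in Lambda_0, see novikov_expE and novikov_exp_ge0. *)
Definition novikov_exp (x : novikov) : novikov := insubd 0 (exp_fun x).

Lemma novikov_expE (x : novikov) d : (0 <= valuation x)%E ->
  novikov_exp x d = exp_fun x d.
Proof. by move=> x0; rewrite /novikov_exp insubdK ?exp_subproof. Qed.

Lemma novikov_exp_ge0 (x : novikov) : (0 <= valuation x)%E ->
  (0 <= valuation (novikov_exp x))%E.
Proof.
move=> x0; apply/valuation_ge0P => d; rewrite novikov_expE//.
apply: contra_neqT => /negP d0; apply: exp_fun_eq0 => k.
have [B _ BP] := expr_supp 0 x0.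
by apply: contra_notP d0 => /eqP/BP[].
Qed.

End NovikovDef.

Section Potential.
Variables (R : realType) (n : nat).

(* <eta, v>, both for v in R^n and for v in Lambda^n. *)
Definition pairing (A : pzRingType) (eta : 'rV[int]_n) (v : 'rV[A]_n) : A :=
  \sum_j (eta 0 j)%:~R * v 0 j.

Definition ell (eta : 'rV[int]_n) (kappa : R) (x : 'rV[R]_n) : R :=
  pairing eta x + kappa.

Record ineqs := Ineqs {
  nineq : nat;
  conormal : 'I_nineq -> 'rV[int]_n;
  offset : 'I_nineq -> R }.

Definition ineq (P : ineqs) (i : 'I_(nineq P)) : 'rV[R]_n -> R :=
  ell (conormal i) (offset i).

Definition polyhedron (P : ineqs) : set 'rV[R]_n :=
  [set x | forall i : 'I_(nineq P), 0 <= ineq i x].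

(* Faces of a polyhedron D, including D itself (c = 0) and the empty face. *)
Definition is_face (D f : set 'rV[R]_n) : Prop :=
  f = set0 \/
  exists c : 'rV[R]_n,
    f = [set x | D x /\
         forall y, D y -> \sum_j c 0 j * x 0 j <= \sum_j c 0 j * y 0 j].

(* The affine hull of f has dimension d: the points x0 and x0 + row i B of f
   form an affine basis of it.  The empty set satisfies this for no d. *)
Definition has_dim (f : set 'rV[R]_n) (d : nat) : Prop :=
  exists (x0 : 'rV[R]_n) (B : 'M[R]_(d, n)),
    [/\ f x0, row_free B, forall i, f (x0 + row i B)
      & forall y, f y -> (y - x0 <= B)%MS].

Definition is_facet (D F : set 'rV[R]_n) : Prop :=
  is_face D F /\ exists2 d, has_dim F d & d.+1 = n.

Definition primitive (eta : 'rV[int]_n) : Prop :=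
  forall d : int, (forall j, (d %| eta ord0 j)%Z) -> `|d|%N = 1%N.

Definition facet_ineq (D F : set 'rV[R]_n) (eta : 'rV[int]_n) (kappa : R) :=
  [/\ is_facet D F, primitive eta,
      forall x, D x -> 0 <= ell eta kappa x
    & F = D `&` [set x | ell eta kappa x = 0]].

(* The empty face has dimension -1. *)
Definition ghost_facet (D : set 'rV[R]_n) (eta : 'rV[int]_n) (kappa : R) :=
  exists f, [/\ is_face D f,
    f = set0 \/ (exists2 d, has_dim f d & (d.+1 < n)%N)
  & forall x, (D `\` f) x -> 0 < ell eta kappa x].

(* Each actual facet contributes exactly one inequality, the one with primitive
   conormal; all other inequalities are ghost facets. *)
Definition presentation (D : set 'rV[R]_n) (P : ineqs) : Prop :=
  [/\ D = polyhedron P,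
      forall F, is_facet D F ->
        exists! i : 'I_(nineq P), facet_ineq D F (conormal i) (offset i)
    & forall i : 'I_(nineq P),
        (exists F, facet_ineq D F (conormal i) (offset i)) \/
        ghost_facet D (conormal i) (offset i)].

Definition geometric_presentation (D : set 'rV[R]_n) (P : ineqs) : Prop :=
  presentation D P /\
  forall i : 'I_(nineq P), ~ ghost_facet D (conormal i) (offset i).

Definition extends_to_basis (P : ineqs) (I : {set 'I_(nineq P)}) : Prop :=
  exists (B : 'M[int]_n) (s : 'I_(nineq P) -> 'I_n),
    [/\ B \in unitmx, {in I &, injective s}
      & {in I, forall i, row (s i) B = conormal i}].

(* The facets meeting at a face f are those containing f. *)
Definition facets_through (P : ineqs) (f : set 'rV[R]_n) :
    {set 'I_(nineq P)} :=
  [set i | `[< f `<=` [set x | ineq i x = 0] >]]%SET.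

(* Full-dimensionality is automatic: if D lies in a hyperplane, its only
   possible facet is D itself, so a geometric presentation of D has at most one
   inequality, and D would be a half-space or the whole space. *)
Definition smooth_polytope (D : set 'rV[R]_n) : Prop :=
  exists2 P : ineqs, geometric_presentation D P &
    forall f d k, is_face D f -> has_dim f d -> (d + k = n)%N ->
      #|facets_through P f| = k /\ extends_to_basis (facets_through P f).

Definition in_Lambda0 (m : nat) (v : 'rV[novikov R]_m) : Prop :=
  forall j, (0 <= valuation (v ord0 j))%E.

Definition potential (P : ineqs) (x : 'rV[R]_n)
    (alpha : 'rV[novikov R]_(nineq P)) (beta : 'rV[novikov R]_n) : novikov R :=
  \sum_(i < nineq P)
    novikov_exp (pairing (conormal i) beta + alpha 0 i) * qpow (ineq i x).

(* D is the j-th partial derivative of W at beta, for the topology on Lambda_0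
   defined by the valuation: (W (beta + h e_j) - W beta) / h tends to D as h
   tends to 0, written without division. *)
Definition is_partial (W : 'rV[novikov R]_n -> novikov R)
    (beta : 'rV[novikov R]_n) (j : 'I_n) (D : novikov R) : Prop :=
  forall E : R, exists K : R, forall h : novikov R,
    (0 <= valuation h)%E -> (K%:E <= valuation h)%E -> h != 0 ->
    (valuation h + E%:E <=
     valuation (W (beta + h *: delta_mx ord0 j) - W beta - h * D)%R)%E.

Definition critical_point (W : 'rV[novikov R]_n -> novikov R)
    (beta : 'rV[novikov R]_n) : Prop :=
  in_Lambda0 beta /\ forall j, is_partial W beta j 0.

Definition has_critical_point (P : ineqs) (x : 'rV[R]_n) : Prop :=
  exists2 alpha : 'rV[novikov R]_(nineq P), in_Lambda0 alpha &
    exists beta, critical_point (potential x alpha) beta.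

Definition nontrivial_qW (D : set 'rV[R]_n) (x : 'rV[R]_n) : Prop :=
  interior D x /\ exists2 P, presentation D P & has_critical_point P x.

Definition subpresentation (P P' : ineqs) : Prop :=
  exists2 g : 'I_(nineq P) -> 'I_(nineq P'), injective g &
    forall i, conormal (g i) = conormal i /\ offset (g i) = offset i.

Definition line_segment (a b : 'rV[R]_n) : set 'rV[R]_n :=
  [set (1 - t) *: a + t *: b | t in [set t : R | 0 <= t <= 1]].

End Potential.

(* Main.v *)
Require Import Defs.
From HB Require Import structures.
From mathcomp Require Import all_boot all_order all_algebra.
From mathcomp Require Import finmap complex ring lra zify.
From mathcomp Require Import all_classical all_reals ereal topology normedtype sequences exp trigo.

Set Implicit Arguments.
Unset Strict Implicit.
Unset Printing Implicit Defensive.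

Import Order.TTheory GRing.Theory Num.Theory numFieldNormedType.Exports.
Local Open Scope classical_set_scope.
Local Open Scope ring_scope.
Local Open Scope complex_scope.

(** The exponential maps Lambda_0 onto series of order zero (with any nonzero
    real constant term, at least), and it satisfies
    exp (x + h) = exp x (1 + h + O(h^2)).  Hence beta is critical for some alpha
    if and only if there are series z_i of order exactly l_i(x) with
    sum_i z_i eta_i = 0: take z_i = exp(<eta_i, beta> + alpha_i) q^(l_i(x)) in
    one direction, and solve exp(alpha_i) = z_i q^(-l_i(x)) with beta = 0 in the
    other.  Since the eta_i have constant coefficients, this is a question about
    the tropicalization of a linear space, and it has a solution exactly when
    every eta_i lies in the span of the other eta_j with l_j(x) <= l_i(x); this
    is [has_critical_point_level].

    Ghost facets.  An integral linear form that is bounded below on a smooth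
    polytope attains its minimum at a point V and is a combination, with
    natural coefficients, of conormals of facets through V
    ([integral_minimum]): these conormals are part of a basis of the lattice.
    Applied to a ghost conormal, integrality of the coefficients shows that the
    ghost inequality is, at interior points, strictly larger than each facet
    inequality occurring in the combination ([ghost_dominated]).  So a ghost
    conormal always lies in the required span, and it can be eliminated from the
    spans used for facets.  The spanning condition therefore depends only on
    the facets.  This gives the second assertion, and for the first one it
    suffices to study the geometric presentation.

    Polygons.  Leaving aside finitely many points that are determined by
    coincidences among the l_i, a point x satisfies the condition only if the
    smallest value is attained at two opposite facets i and j, and the next one
    at two facets k and l whose inequalities agree on the whole middle line of i
    and j ([critical_doubled]).  The pair i, j is unique, since its width is
    least ([doubled_same_pair]).  Along the middle line the l_r are affine with
    integral slopes; smoothness implies that where they exceed the common value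
    of l_i and l_j, the smallest of them has slope 1 or -1
    ([slope_one_below]).  Functions of equal slope differ by a constant
    along the line, so the condition persists between any two points where it
    holds ([doubled_between]).  Being closed, it holds on one segment
    ([polygon_critical_set]). *)

(** * The exponential series *)

Section DividedPowers.
Variables (F : numFieldType) (A : comNzRingType) (f : {rmorphism F -> A}).

(** The scalars enter through a morphism, so that complex numbers (through the
    identity) and Novikov series (through the constants) share the formula for
    products of exponentials. *)
Definition divpow (k : nat) (x : A) : A := f (k`!%:R^-1) * x ^+ k.

Definition expsum (m : nat) (x : A) : A := \sum_(k < m) divpow k x.

Lemma divpowD k (x y : A) :
  divpow k (x + y) = \sum_(i < k.+1) divpow i x * divpow (k - i) y.
Proof.
rewrite /divpow addrC exprDn mulr_sumr; apply: eq_bigr => i _.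
have ik : (i <= k)%N by rewrite -ltnS.
rewrite mulrACA -rmorphM [x ^+ i * _]mulrC mulrnAr -mulrnAl -rmorphMn.
congr (f _ * _).
have nz m : m`!%:R != 0 :> F by rewrite pnatr_eq0 -lt0n fact_gt0.
have nb : ('C(k, i))%:R != 0 :> F by rewrite pnatr_eq0 -lt0n bin_gt0.
rewrite -(bin_fact ik) !natrM. by rewrite -mulr_natr; field; rewrite nb !nz.
Qed.

Lemma triangle_sum (G : nat -> nat -> A) m :
  \sum_(k < m) \sum_(i < k.+1) G i (k - i)%N
  = \sum_(i < m) \sum_(0 <= j < m - i) G i j.
Proof.
elim: m => [|m IH]; first by rewrite !big_ord0.
rewrite big_ord_recr /= IH.
under [RHS]eq_bigr => i _.
  rewrite subSn ?leq_ord // big_nat_recr //=; over.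
rewrite big_split /=; congr (_ + _).
by rewrite [RHS]big_ord_recr /= subnn big_geq ?addr0.
Qed.

(** The Cauchy product of two truncated exponentials is the truncated
    exponential of the sum, up to the terms of total degree at least [m]. *)
Lemma expsumM m (x y : A) :
  expsum m x * expsum m y - expsum m (x + y) =
  \sum_(i < m) \sum_(m - i <= j < m) divpow i x * divpow j y.
Proof.
rewrite /expsum; under [X in _ - X]eq_bigr do rewrite divpowD.
rewrite (triangle_sum (fun i j => divpow i x * divpow j y)) mulr_suml -sumrB.
apply: eq_bigr => i _; rewrite mulr_sumr -(big_mkord xpredT (fun j => divpow i x * divpow j y)).
by rewrite (big_cat_nat _ (leq_subr i m)) //= [X in X - _]addrC addrK.
Qed.

Lemma expsum0 m : expsum m.+1 0 = 1.
Proof.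
rewrite /expsum big_ord_recl big1 ?addr0 => [|i _].
  by rewrite /divpow expr0 invr1 rmorph1 mulr1.
by rewrite /divpow expr0n mulr0.
Qed.

End DividedPowers.

Lemma cvg_mul_near (K : numFieldType) (u v w : nat -> K^o) (l l' : K^o) :
  u @ \oo --> l -> v @ \oo --> l' ->
  (fun m => u m * v m - w m : K^o) @ \oo --> (0 : K^o) -> w @ \oo --> (l * l' : K^o).
Proof.
move=> ul vl uvw; rewrite -(subr0 (l * l')).
rewrite (_ : w = (fun m => u m * v m - (u m * v m - w m))); last first.
  by apply/funext => m /=; rewrite opprB addrC subrK.
by apply: cvgB => //; exact: cvgM.
Qed.

Section ComplexExp.
Variable R : realType.
Local Notation C := R[i].

Local Notation cexpsum := (@expsum C C idfun).

(** In this form it is clear that the exponential does not vanish and that it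
    takes all nonzero real values; [cvg_cexp] is the link with the series. *)
Definition cexp (c : C) : C :=
  (expR (complex.Re c))%:C * (cos (complex.Im c) +i* sin (complex.Im c)).

Lemma cvg_realC (s : nat -> R) (l : R) : s @ \oo --> l ->
  (fun m => (s m)%:C : C^o) @ \oo --> (l%:C : C^o).
Proof.
move=> /cvgrPdist_lt sl; apply/cvgrPdist_lt => e e0.
have er : (complex.Re e)%:C = e by rewrite RRe_real // gtr0_real.
have e0' : 0 < complex.Re e by rewrite -ltcR er.
near=> m; rewrite -er -rmorphB.
rewrite [X in X < _]normc_def /= expr0n addr0 sqrtr_sqr ltcR.
by near: m; exact: sl.
Unshelve. all: by end_near. Qed.

Lemma cexpsum_real m (r : R) : cexpsum m r%:C = (series (exp_coeff r) m)%:C.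
Proof.
rewrite /expsum /series /= big_mkord rmorph_sum; apply: eq_bigr => k _.
by rewrite /divpow /exp_coeff /= mulrC rmorphM rmorphXn fmorphV rmorph_nat.
Qed.

Lemma cexpsum_imag m (b : R) : cexpsum m (b%:C * 'i) =
  (series (cos_coeff b) m)%:C + (series (sin_coeff b) m)%:C * 'i.
Proof.
rewrite /expsum /series /= !big_mkord !rmorph_sum mulr_suml -big_split /=.
apply: eq_bigr => k _; rewrite /divpow /cos_coeff /sin_coeff /=.
rewrite exprMn !rmorphM !rmorphXn !fmorphV !rmorph_nat !rmorphN !rmorph1 /=.
rewrite -[X in 'i ^+ X](odd_double_half k) exprD -mul2n exprM sqr_i.
have [ok|ek] := boolP (odd k); rewrite !(mul0r, mul1r, add0r, addr0, expr0, expr1).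
  have -> : k.-1./2 = k./2     by case: (nat_of_ord k) ok => // n; rewrite oddS => /negbTE no; rewrite -uphalfE uphalf_half no.
  by ring.
by ring.
Qed.

(** The defect of multiplicativity of the partial sums is dominated by the
    same defect for the real series at the absolute values, where it tends
    to zero because the real exponential is multiplicative. *)
Lemma cvg_cexpsumD (x y l l' : C) :
  (fun m => cexpsum m x : C^o) @ \oo --> (l : C^o) ->
  (fun m => cexpsum m y : C^o) @ \oo --> (l' : C^o) ->
  (fun m => cexpsum m (x + y) : C^o) @ \oo --> (l * l' : C^o).
Proof.
move=> xl yl.
pose a : R := Normc.normc x; pose b : R := Normc.normc y.
have na : `|x| = a%:C by [].
have nb : `|y| = b%:C by [].
pose d m := series (exp_coeff a) m * series (exp_coeff b) m - series (exp_coeff (a + b)) m.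
have d0 : d @ \oo --> 0.
  rewrite -(subrr (expR (a + b))) {1}expRD.
  by apply: cvgB; [apply: cvgM|]; apply: is_cvg_series_exp_coeff.
have dE m : (d m)%:C = \sum_(i < m) \sum_(m - i <= j < m) @divpow C C idfun i `|x| * @divpow C C idfun j `|y|.
  by rewrite -expsumM na nb -rmorphD !cexpsum_real -rmorphM -rmorphB.
have le m : `|cexpsum m x * cexpsum m y - cexpsum m (x + y)| <= (d m)%:C.
  rewrite dE expsumM; apply: le_trans (ler_norm_sum _ _ _) _.
  apply: ler_sum => i _; apply: le_trans (ler_norm_sum _ _ _) _.
  apply: ler_sum => j _; rewrite /divpow /=.
  by rewrite !normrM !normrX !normfV !normr_nat.
have dC := cvg_realC d0.
have xy0 : (fun m => cexpsum m x * cexpsum m y - cexpsum m (x + y) : C^o) @ \oo --> (0 : C^o).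
  apply/(@cvgrPdist_lt _ C^o). move => e e0; move/cvgrPdist_lt: dC => /(_ e e0) dC.
  apply: filterS dC => m; rewrite sub0r normrN => dC.
  rewrite sub0r normrN; apply: le_lt_trans (le m) _.
  have dm : 0 <= (d m)%:C by apply: le_trans (le m).
  by rewrite -(ger0_norm dm).
exact: cvg_mul_near xl yl xy0.
Qed.

Lemma cvg_cexp (c : C) : (fun m => cexpsum m c : C^o) @ \oo --> (cexp c : C^o).
Proof.
rewrite [in X in X @ _](complexE c) /cexp; apply: cvg_cexpsumD.
  under eq_fun do rewrite cexpsum_real.
  by apply: cvg_realC; exact: is_cvg_series_exp_coeff.
rewrite [X in X @ _](_ : _ = fun m => (series (cos_coeff (complex.Im c)) m)%:C + (series (sin_coeff (complex.Im c)) m)%:C * 'i); last first.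
  by apply/funext => m; rewrite -cexpsum_imag mulrC.
rewrite [_ +i* _]complexE /= [_ * (sin _)%:C]mulrC.
apply: cvgD; first by apply: cvg_realC; rewrite unlock; exact: is_cvg_series_cos_coeff.
apply: cvgM; last exact: cvg_cst.
by apply: cvg_realC; rewrite unlock; exact: is_cvg_series_sin_coeff.
Qed.

Lemma cexp_neq0 (c : C) : cexp c != 0.
Proof.
rewrite mulf_neq0 //; first by rewrite eq_complex /= eqxx andbT gt_eqF ?expR_gt0.
apply/negP => /eqP[c0 s0]; have := cos2Dsin2 (complex.Im c).
by rewrite c0 s0 !expr0n addr0 => /eqP; rewrite eq_sym oner_eq0.
Qed.

(** Negative numbers are reached with imaginary part pi. *)
Lemma cexp_surj_real (r : R) : r != 0 -> exists c, cexp c = r%:C.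
Proof.
move=> r0; have [rp|] := ltP 0 r.
  exists (ln r)%:C; rewrite /cexp /= lnK ?posrE // cos0 sin0.
  by rewrite -[1 +i* 0]/(1 : C) mulr1.
rewrite le_eqVlt (negbTE r0) /= => rn; exists (ln (- r) +i* pi).
rewrite /cexp /= lnK ?posrE ?oppr_gt0 // cospi sinpi.
by apply/eqP; rewrite eq_complex /= !mul0r !mulr0 !subr0 addr0 mulrNN mulr1 !eqxx.
Qed.
End ComplexExp.

(** * The Novikov ring *)

Section Novikov.
Variable R : realType.
Local Notation C := R[i].
Local Notation L := (novikov R).
Implicit Types (x y u h : L) (a b d e : R).

(** A lower bound for the order, stated on coefficients to stay within real
    numbers also when the series is zero. *)
Definition vge x e : bool := `[< forall d, x d != 0 -> e <= d >].

Lemma vge_le x e d : vge x e -> x d != 0 -> e <= d.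
Proof. by move/asboolP; exact. Qed.

Lemma vgeP x e : (e%:E <= valuation x)%E <-> vge x e.
Proof.
split=> [vx|/asboolP xe].
  apply/asboolP => d xd.
  by rewrite -lee_fin; apply: le_trans vx _; apply: ereal_inf_lbound; exists d.
by apply: le_ereal_inf_tmp => _ [d /xe d0 <-]; rewrite lee_fin.
Qed.

Lemma vge_coef0 x e d : vge x e -> d < e -> x d = 0.
Proof. by move=> xe de; apply: contraTeq de => /(vge_le xe); rewrite -leNgt. Qed.

Lemma vgeW x e e' : vge x e -> e' <= e -> vge x e'.
Proof. by move=> xe le; apply/asboolP => d /(vge_le xe); exact: le_trans. Qed.

Lemma nov_coefN x d : (- x) d = - x d. Proof. by []. Qed.

Lemma nov_coefB x y d : (x - y) d = x d - y d. Proof. by []. Qed.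

Lemma nov_coef_sum (I : Type) (r : seq I) (P : pred I) (F : I -> L) d :
  (\sum_(i <- r | P i) F i) d = \sum_(i <- r | P i) F i d.
Proof.
apply: (big_rec2 (fun (x : L) c => x d = c)) => [|i c x _ <-]; first exact: Defs.coef0.
exact: Defs.coefD.
Qed.

Lemma vge0 e : vge 0 e. Proof. by apply/asboolP => d; rewrite Defs.coef0 eqxx. Qed.

Lemma vgeD x y e : vge x e -> vge y e -> vge (x + y) e.
Proof.
move=> xe ye; apply/asboolP => d; have [//|de] := leP e d.
by rewrite Defs.coefD (vge_coef0 xe de) (vge_coef0 ye de) addr0 eqxx.
Qed.

Lemma vgeN x e : vge x e -> vge (- x) e.
Proof. by move=> xe; apply/asboolP => d; rewrite nov_coefN oppr_eq0; exact: vge_le. Qed.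

Lemma vgeB x y e : vge x e -> vge y e -> vge (x - y) e.
Proof. by move=> xe /vgeN; exact: vgeD. Qed.

Lemma vge_sum (I : Type) (r : seq I) (P : pred I) (F : I -> L) e :
  (forall i, P i -> vge (F i) e) -> vge (\sum_(i <- r | P i) F i) e.
Proof.
move=> Fe; apply: (big_ind (fun x => vge x e)) => //; first exact: vge0.
move=> x y xe ye; exact: vgeD.
Qed.

Lemma nov_coefM x y d : (x * y) d = \sum_(e \in [set: R]) x e * y (d - e).
Proof. by []. Qed.

Lemma vgeM x y a b : vge x a -> vge y b -> vge (x * y) (a + b).
Proof.
move=> xa yb; apply/asboolP => d /cauchy_neq0[e [/(vge_le xa) le /(vge_le yb)]].
by rewrite lerBrDr addrC; apply: le_trans; rewrite lerD2r.
Qed.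

Lemma vge1 : vge 1 0.
Proof.
apply/asboolP => d; rewrite -[1]/(qpow 0) /= /qpow_fun.
by case: (d =P 0) => [->|]; rewrite ?eqxx.
Qed.

Lemma vgeX x e k : vge x e -> vge (x ^+ k) (k%:R * e).
Proof.
move=> xe; elim: k => [|k IH]; first by rewrite mul0r expr0; exact: vge1.
by rewrite exprS -natr1 mulrDl mul1r addrC; exact: vgeM.
Qed.

Lemma coefM_lead x y a b : vge x a -> vge y b -> (x * y) (a + b) = x a * y b.
Proof.
move=> xa yb; rewrite nov_coefM -(fsbig_widen [set a])//.
  by rewrite fsbig_set1 addrC addKr.
move=> e [_ /= /eqP ea]; have [lt|gt|//] := ltgtP e a; last by move: ea => /[swap]->; rewrite eqxx.
  by rewrite (vge_coef0 xa lt) mul0r.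
by rewrite (vge_coef0 yb) ?mulr0 // ltrBlDr addrC ltrD2l.
Qed.

Definition cst_fun (c : C) : R -> C := fun d => if d == 0 then c else 0.

Lemma cst_subproof c : cst_fun c \in @novikov_pred R.
Proof.
have sub : series_supp (cst_fun c) `<=` [set 0].
  by move=> d; rewrite /series_supp /cst_fun /=; case: (eqVneq d 0) => // _; rewrite eqxx.
apply/asboolP/novikovP; split; first by exists 0 => d /sub ->.
by move=> b; apply: sub_finite_set (finite_set1 0) => d [/sub].
Qed.

Definition nconst c : L := Novikov (cst_subproof c).

Lemma cst_coef0 c : nconst c 0 = c. Proof. by rewrite /= /cst_fun eqxx. Qed.

Lemma cst_coefn c d : d != 0 -> nconst c d = 0.
Proof. by rewrite /= /cst_fun => /negbTE ->. Qed.

Lemma vge_cst c : vge (nconst c) 0.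
Proof. by apply/asboolP => d /=; rewrite /cst_fun; case: (d =P 0) => [->|]; rewrite ?eqxx. Qed.

Lemma coefM_cst c x d : (nconst c * x) d = c * x d.
Proof.
rewrite nov_coefM -(fsbig_widen [set 0])//; first by rewrite fsbig_set1 cst_coef0 subr0.
by move=> e [_ /= /eqP e0]; rewrite /cst_fun (negbTE e0) mul0r.
Qed.

Lemma cst_is_zmod_morphism : zmod_morphism nconst.
Proof.
move=> c c'; apply: novikov_eqP => d; rewrite nov_coefB /= /cst_fun.
by case: (d == 0); rewrite ?subr0.
Qed.

Lemma cst_is_monoid_morphism : monoid_morphism nconst.
Proof.
split=> [|c c']; apply: novikov_eqP => d.
  by rewrite -[1 in RHS]/(qpow 0) /= /cst_fun /qpow_fun; case: (d == 0).
by rewrite coefM_cst /= /cst_fun; case: (d == 0); rewrite ?mulr0.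
Qed.

HB.instance Definition _ := GRing.isZmodMorphism.Build C L nconst cst_is_zmod_morphism.
HB.instance Definition _ := GRing.isMonoidMorphism.Build C L nconst cst_is_monoid_morphism.

Lemma vge_qpow e : vge (qpow e) e.
Proof. by apply/asboolP => d /=; rewrite /qpow_fun; case: (d =P e) => [->|]; rewrite ?eqxx. Qed.

Lemma qpow_coef e : qpow e e = 1.
Proof. by rewrite /= /qpow_fun eqxx. Qed.

Lemma coefM_qpow x e d : (x * qpow e) d = x (d - e).
Proof.
rewrite mulrC nov_coefM -(fsbig_widen [set e])//; first by rewrite fsbig_set1 qpow_coef mul1r.
by move=> a [_ /= /eqP e0]; rewrite /qpow_fun (negbTE e0) mul0r.
Qed.

Lemma qpowD a b : qpow a * qpow b = qpow (a + b) :> L.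
Proof.
by apply: novikov_eqP => d; rewrite coefM_qpow /= /qpow_fun subr_eq.
Qed.

Lemma qpow0 : qpow 0 = 1 :> L. Proof. by []. Qed.

(** The support is locally finite, hence does not accumulate at zero. *)
Lemma vge_gap x : vge x 0 -> x 0 = 0 -> exists2 e, 0 < e & vge x e.
Proof.
move=> x0 xz; pose A := [set d | x d != 0 /\ d <= 1].
have finA : finite_set A := coef_fin x 1.
exists (\big[Num.min/1]_(d <- fset_set A) d).
  rewrite big_seq; apply: (big_ind (fun c => 0 < c)) => //.
    by move=> u v u0 v0; rewrite lt_min u0.
  move=> d; rewrite in_fset_set// inE => -[xd _].
  by rewrite lt_neqAle (vge_le x0) // andbT; apply: contraNneq xd => <-; rewrite xz.
apply/asboolP => d xd; have [d1|d1] := leP d 1.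
  by apply: (@ge_bigmin_seq _ _ _ _ _ d xpredT id) => //; rewrite in_fset_set ?inE.
exact: le_trans (bigmin_le_id _ _ _ _) (ltW d1).
Qed.

Lemma vge_min x : x != 0 -> exists2 e, x e != 0 & vge x e.
Proof.
move=> x0; have [d xd] : exists d, x d != 0.
  apply: contrapT => h; move/eqP: x0; apply; apply: novikov_eqP => d.
  by rewrite Defs.coef0; apply/eqP/negPn/negP => xd; apply: h; exists d.
pose A := [set e | x e != 0 /\ e <= d].
have finA : finite_set A := coef_fin x d.
pose m := \big[Num.min/d]_(e <- fset_set A) e.
have mA : m \in A.
  rewrite /m big_seq; apply: (big_ind (fun c => c \in A)).
  - by rewrite inE.
  - by move=> u v; rewrite /Num.min; case: ifP.
  - by move=> e; rewrite in_fset_set.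
exists m; first by move: mA; rewrite inE => -[].
apply/asboolP => e xe; have [ed|ed] := leP e d.
  by apply: (@ge_bigmin_seq _ _ _ _ _ e xpredT id) => //; rewrite in_fset_set ?inE.
exact: le_trans (bigmin_le_id _ _ _ _) (ltW ed).
Qed.

Lemma valuation_eq x e : x e != 0 -> vge x e -> valuation x = e%:E.
Proof.
move=> xe xv; apply/eqP; rewrite eq_le; apply/andP; split; last exact/vgeP.
by apply: ereal_inf_lbound; exists e.
Qed.

(** ** Power series at elements of positive order *)

Definition psum (c : nat -> C) u M : L := \sum_(k < M) nconst (c k) * u ^+ k.

Lemma vge_psum_term c u e k : vge u e -> vge (nconst c * u ^+ k) (k%:R * e).
Proof. by move=> ue; have := vgeM (vge_cst c) (vgeX k ue); rewrite add0r. Qed.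

Lemma vge_psumB c u e M M' : 0 < e -> vge u e -> (M <= M')%N ->
  vge (psum c u M' - psum c u M) (M%:R * e).
Proof.
move=> e0 ue le; rewrite /psum -!(big_mkord xpredT (fun k => nconst (c k) * u ^+ k)).
rewrite (big_cat_nat _ le) //= [X in vge (X - _)]addrC addrK big_seq.
apply: vge_sum => k; rewrite mem_index_iota => /andP[Mk _].
by apply: vgeW (vge_psum_term _ _ ue) _; rewrite ler_pM2r // ler_nat.
Qed.

Lemma psum_stable c u e M M' d : 0 < e -> vge u e -> d < M%:R * e -> d < M'%:R * e ->
  psum c u M d = psum c u M' d.
Proof.
move=> e0 ue; wlog le : M M' / (M <= M')%N => [W dM dM'|].
  by have [le|/ltnW le] := leqP M M'; [exact: W|apply/esym/W].
move=> dM _; apply/eqP; rewrite eq_sym -subr_eq0 -nov_coefB.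
by rewrite (vge_coef0 (vge_psumB c e0 ue le)).
Qed.

Definition novser_fun c u e : R -> C := fun d => psum c u (Num.truncn (d / e)).+1 d.

(** When [u] has order at least [e > 0], the powers [u ^+ k] with [d < k e] do
    not contribute in degree [d], so that each coefficient is read off a partial
    sum. *)
Definition novser c u e : L := insubd 0 (novser_fun c u e).

Lemma vge_psum c u M : vge u 0 -> vge (psum c u M) 0.
Proof.
by move=> u0; apply: vge_sum => k _; have := vge_psum_term (c k) k u0; rewrite mulr0.
Qed.

Lemma novser_coef c u e M d : 0 < e -> vge u e -> d < M%:R * e ->
  novser c u e d = psum c u M d.
Proof.
move=> e0 ue dM.
have gt d' : d' < (Num.truncn (d' / e)).+1%:R * e.
  by rewrite -ltr_pdivrMr // truncnS_gt.
suff ok : novser_fun c u e \in @novikov_pred R.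
  by rewrite /novser insubdK //; exact: psum_stable (gt d) dM.
have u0 : vge u 0 by apply: vgeW ue _; exact: ltW.
apply/asboolP/novikovP; split; first by exists 0 => d' /(vge_le (vge_psum _ _ u0)).
move=> b; have := coef_fin (psum c u (Num.truncn (b / e)).+1) b.
apply: sub_finite_set => d' [/= pd db]; split=> //.
rewrite (psum_stable c e0 ue (M' := (Num.truncn (d' / e)).+1)) //.
exact: le_lt_trans (gt b).
Qed.

Lemma novser_approx c u e M : 0 < e -> vge u e ->
  vge (novser c u e - psum c u M) (M%:R * e).
Proof.
move=> e0 ue; apply/asboolP => d; apply: contra_neqT; rewrite -ltNge => dM.
by rewrite nov_coefB (novser_coef c e0 ue dM) subrr.
Qed.

Lemma vge_novser c u e : 0 < e -> vge u e -> vge (novser c u e) 0.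
Proof.
move=> e0 ue; have := novser_approx c 0 e0 ue.
by rewrite mul0r /psum big_ord0 subr0.
Qed.

Lemma novser_coef0 c u e : 0 < e -> vge u e -> novser c u e 0 = c 0%N.
Proof.
move=> e0 ue; rewrite (novser_coef (M := 1) c e0 ue) ?mul1r //.
by rewrite /psum big_ord1 expr0 mulr1 cst_coef0.
Qed.

(** Identities between power series are proved on partial sums, modulo
    arbitrarily high powers of [q]. *)
Lemma vge_eq x y e : 0 < e -> (forall M, vge (x - y) (M%:R * e)) -> x = y.
Proof.
move=> e0 xy; apply/eqP; rewrite -subr_eq0; apply/eqP/novikov_eqP => d.
rewrite Defs.coef0; apply: vge_coef0 (xy (Num.truncn (d / e)).+1) _.
by rewrite -ltr_pdivrMr // truncnS_gt.
Qed.

End Novikov.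

Section NovikovExp.
Variable R : realType.
Local Notation C := R[i].
Local Notation L := (novikov R).
Implicit Types (x y u h : L) (a b d e : R).

Definition invfact (k : nat) : C := k`!%:R^-1.

Local Notation pexp := (novser invfact).

Lemma psum_expsum u M : psum invfact u M = expsum (@nconst R) M u.
Proof. by []. Qed.

Lemma cvg_sum (K : numFieldType) M (f : nat -> nat -> K^o) (l : nat -> K^o) :
  (forall i, f i @ \oo --> l i) ->
  (fun m => \sum_(i < M) f i m : K^o) @ \oo --> (\sum_(i < M) l i : K^o).
Proof.
move=> fl; elim: M => [|M IH].
  by under eq_fun do rewrite big_ord0; rewrite big_ord0; exact: cvg_cst.
under eq_fun do rewrite big_ord_recr /=.
by rewrite big_ord_recr /=; apply: cvgD.
Qed.

Lemma limn_weighted_sums (K : numFieldType) M (w s t : nat -> K^o) (l : K^o) :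
  s @ \oo --> l ->
  (forall m, (M <= m)%N -> t m = \sum_(i < M) w i * s (m - i)%N) ->
  t @ \oo --> (\sum_(i < M) w i * l : K^o).
Proof.
move=> sl tE.
have H : (fun m => \sum_(i < M) (fun i m => w i * s (m - i)%N) i m : K^o) @ \oo
   --> (\sum_(i < M) (fun i => w i * l) i : K^o).
  apply: (@cvg_sum K M (fun i m => w i * s (m - i)%N) (fun i => w i * l)) => i.
  apply: cvgM; first exact: cvg_cst.
  by rewrite cvg_centern.
apply: cvg_trans H; apply: near_eq_cvg.
by exists M => // m /= Mm; rewrite tE.
Qed.

(** Reordering by powers of [u] isolates partial sums of the complex exponential
    of [c]; only boundedly many powers matter in a given degree. *)
Lemma expsum_cstD c u M m d : (forall k, (M <= k)%N -> (u ^+ k) d = 0) -> (M <= m)%N ->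
  expsum (@nconst R) m (nconst c + u) d =
  \sum_(i < M) (divpow (@nconst R) i u d) * expsum (@idfun C) (m - i) c.
Proof.
move=> uM Mm; rewrite /expsum; under eq_bigr do rewrite addrC divpowD.
rewrite (triangle_sum (fun i j => divpow (@nconst R) i u * divpow (@nconst R) j (nconst c))).
rewrite nov_coef_sum -(big_mkord xpredT (fun i => (\sum_(0 <= j < m - i)
   divpow (@nconst R) i u * divpow (@nconst R) j (nconst c)) d)).
rewrite (big_cat_nat _ Mm) //= [X in _ + X]big_nat_cond [X in _ + X]big1 ?addr0; last first.
  move=> i; rewrite andbT => /andP[Mi _]; rewrite nov_coef_sum big1 // => j _.
  have -> : divpow (@nconst R) i u * divpow (@nconst R) j (nconst c) =
      nconst (i`!%:R^-1 * (j`!%:R^-1 * c ^+ j)) * u ^+ i.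
    by rewrite /divpow !rmorphM rmorphXn /=; ring.
  by rewrite coefM_cst uM ?mulr0.
rewrite big_mkord; apply: eq_bigr => i _.
rewrite -mulr_sumr mulrC.
have -> : \sum_(0 <= j < m - i) divpow (@nconst R) j (nconst c) =
   nconst (\sum_(j < m - i) divpow (@idfun C) j c) :> L.
  by rewrite big_mkord rmorph_sum; apply: eq_bigr => j _; rewrite /divpow rmorphM rmorphXn.
by rewrite coefM_cst mulrC.
Qed.

(** The constant term contributes the complex exponential; the rest is a
    formal power series. *)
Lemma novikov_exp_cstD c u e : 0 < e -> vge u e ->
  novikov_exp (nconst c + u) = nconst (cexp c) * pexp u e.
Proof.
move=> e0 ue; have u0 : vge u 0 by apply: vgeW ue _; exact: ltW.
apply: novikov_eqP => d.
rewrite novikov_expE; last by apply/vgeP/vgeD => //; exact: vge_cst.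
have [M dM] : exists M : nat, d < M%:R * e.
  by exists (Num.truncn (d / e)).+1; rewrite -ltr_pdivrMr // truncnS_gt.
rewrite coefM_cst (novser_coef _ e0 ue dM) psum_expsum /expsum nov_coef_sum mulrC mulr_suml.
rewrite /exp_fun; apply: (@cvg_lim C^o); first exact: norm_hausdorff.
apply: (@limn_weighted_sums C M (fun i => divpow (@nconst R) i u d)
  (fun m => expsum (@idfun C) m c) _ (cexp c)) => [|m Mm]; first exact: cvg_cexp.
rewrite -(@expsum_cstD c u M m d) // => [|k Mk].
  rewrite /expsum nov_coef_sum; apply: eq_bigr => k _.
  by rewrite /divpow coefM_cst mulrC.
by apply: vge_coef0 (vgeX k ue) _; apply: lt_le_trans dM _; rewrite ler_pM2r // ler_nat.
Qed.

(** Partial sums are multiplicative up to terms of high total degree. *)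
Lemma pexpD u h e : 0 < e -> vge u e -> vge h e -> pexp (u + h) e = pexp u e * pexp h e.
Proof.
move=> e0 ue he; apply: (vge_eq e0) => M.
have uhe := vgeD ue he.
have S0 v : vge v e -> vge (psum invfact v M) 0.
  by move=> ve; apply: vge_psum; apply: vgeW ve _; exact: ltW.
have -> : pexp (u + h) e - pexp u e * pexp h e =
  (pexp (u + h) e - psum invfact (u + h) M)
  - (psum invfact u M * psum invfact h M - psum invfact (u + h) M)
  - ((pexp u e - psum invfact u M) * pexp h e
     + psum invfact u M * (pexp h e - psum invfact h M)).
  move: (pexp (u + h) e) (pexp u e) (pexp h e) (psum _ (u + h) M) (psum _ u M) (psum _ h M).
  by move=> *; ring.
apply: vgeB; first apply: vgeB; first exact: novser_approx.
  rewrite !psum_expsum expsumM; apply: vge_sum => i _.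
  rewrite big_seq; apply: vge_sum => j; rewrite mem_index_iota => /andP[ij _].
  have := vgeM (vge_psum_term (invfact i) i ue) (vge_psum_term (invfact j) j he).
  rewrite -mulrDl -natrD => H; apply: vgeW H _.
  by rewrite ler_pM2r // ler_nat -leq_subLR.
apply: vgeD.
  by have := vgeM (novser_approx invfact M e0 ue) (vge_novser invfact e0 he); rewrite addr0.
by have := vgeM (S0 _ ue) (novser_approx invfact M e0 he); rewrite add0r.
Qed.

Lemma pexp0 e : 0 < e -> pexp 0 e = 1.
Proof.
move=> e0; apply: (vge_eq e0) => M.
have := novser_approx invfact M.+1 e0 (vge0 e); rewrite psum_expsum expsum0.
by move=> H; apply: vgeW H _; rewrite ler_pM2r // ler_nat.
Qed.

(** ** The derivation q d/dq *)

Definition dq_fun x : R -> C := fun d => d%:C * x d.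

Lemma dq_subproof x : dq_fun x \in @novikov_pred R.
Proof.
have sub d : dq_fun x d != 0 -> x d != 0.
  by apply: contra_neq => xd; rewrite /dq_fun xd mulr0.
apply/asboolP/novikovP; split.
  by have [l lx] := coef_lbound x; exists l => d /sub; exact: lx.
by move=> b; apply: sub_finite_set (coef_fin x b) => d [/sub].
Qed.

Definition dq x : L := Novikov (dq_subproof x).

Lemma dqE x d : dq x d = d%:C * x d. Proof. by []. Qed.

Lemma dq_is_zmod_morphism : zmod_morphism dq.
Proof. by move=> x y; apply: novikov_eqP => d; rewrite nov_coefB !dqE nov_coefB mulrBr. Qed.

HB.instance Definition _ := GRing.isZmodMorphism.Build L L dq dq_is_zmod_morphism.

Lemma dqM x y : dq (x * y) = dq x * y + x * dq y.
Proof.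
apply: novikov_eqP => d; rewrite dqE Defs.coefD !nov_coefM.
pose A := [set e | x e * y (d - e) != 0].
have finA : finite_set A := cauchy_finite x y d.
have wid (F : R -> C) : (forall e, x e * y (d - e) = 0 -> F e = 0) ->
   \sum_(e \in [set: R]) F e = \sum_(e \in A) F e.
  move=> F0; apply/esym/fsbig_widen => // e [_ /= /negP/negPn/eqP]; exact: F0.
rewrite !wid // => [|e xy|e xy]; last 2 first.
- by rewrite dqE mulrCA xy mulr0.
- by rewrite dqE -mulrA xy mulr0.
rewrite -fsbig_split // mulr_fsumr; apply: eq_fsbigr => e _ /=.
rewrite /dq_fun /= rmorphB; ring.
Qed.

Lemma vge_dq x e : vge x e -> vge (dq x) e.
Proof.
move=> xe; apply/asboolP => d; have [//|de] := leP e d.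
by rewrite dqE (vge_coef0 xe de) mulr0 eqxx.
Qed.

Lemma dq_cst c : dq (nconst c) = 0.
Proof.
apply: novikov_eqP => d; rewrite dqE Defs.coef0.
by have [->|d0] := eqVneq d 0; rewrite ?mul0r // cst_coefn ?mulr0.
Qed.

Lemma dqX u k : dq (u ^+ k.+1) = k.+1%:R * u ^+ k * dq u.
Proof.
elim: k => [|k IH]; first by rewrite expr1 mulr1 mul1r.
by rewrite exprS dqM IH -[k.+2%:R]natr1 !exprS; ring.
Qed.

Definition derive_coef (c : nat -> C) (k : nat) : C := k.+1%:R * c k.+1.

Lemma dq_psum c u M : dq (psum c u M.+1) = psum (derive_coef c) u M * dq u.
Proof.
rewrite /psum big_ord_recl expr0 mulr1 raddfD /= dq_cst add0r raddf_sum mulr_suml.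
apply: eq_bigr => k _; rewrite /= dqM dq_cst mul0r add0r dqX !rmorphM rmorph_nat.
by rewrite /bump /= add1n; ring.
Qed.

Lemma dq_novser c u e : 0 < e -> vge u e ->
  dq (novser c u e) = novser (derive_coef c) u e * dq u.
Proof.
move=> e0 ue; apply: (vge_eq e0) => M.
have -> : dq (novser c u e) - novser (derive_coef c) u e * dq u =
  dq (novser c u e - psum c u M.+1)
  - (novser (derive_coef c) u e - psum (derive_coef c) u M) * dq u.
  rewrite raddfB /= dq_psum; move: (dq (novser c u e)) (dq u) (novser (derive_coef c) u e) (psum _ u M).
  by move=> *; ring.
apply: vgeB.
  apply/vge_dq/(vgeW (novser_approx _ _ e0 ue)).
  by rewrite ler_pM2r // ler_nat.
have := vgeM (novser_approx (derive_coef c) M e0 ue) (vge_dq ue).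
by move=> H; apply: vgeW H _; rewrite lerDl ltW.
Qed.

Lemma dq_pexp u e : 0 < e -> vge u e -> dq (pexp u e) = pexp u e * dq u.
Proof.
move=> e0 ue; have E : derive_coef invfact = invfact.
  apply/funext => k; rewrite /derive_coef /invfact factS natrM invfM mulrA.
  by rewrite mulfV ?mul1r // pnatr_eq0.
by rewrite (dq_novser _ e0 ue) E.
Qed.

Definition altcoef (k : nat) : C := (-1) ^+ k.

Lemma geometricE u e : 0 < e -> vge u e -> (1 + u) * novser altcoef u e = 1.
Proof.
move=> e0 ue; apply: (vge_eq e0) => M.
have u1 : vge (1 + u) 0.
  by apply: vgeD (vge1 R) (vgeW ue _); exact: ltW.
have -> : (1 + u) * novser altcoef u e - 1 =
   (1 + u) * (novser altcoef u e - psum altcoef u M) - (- u) ^+ M.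
  have -> : psum altcoef u M = \sum_(k < M) (- u) ^+ k.
    apply: eq_bigr => k _; rewrite rmorphXn rmorphN rmorph1 -exprMn mulN1r //.
  have := subrX1 (- u) M; set S := \sum_(_ < _) _ => H.
  have -> : (- u) ^+ M = (- u - 1) * S + 1 by rewrite -H subrK.
  by move: (novser _ u e) S {H} => *; ring.
apply: vgeB; first by have := vgeM u1 (novser_approx altcoef M e0 ue); rewrite add0r.
by apply: vgeX; apply: vgeN.
Qed.

Definition logcoef (k : nat) : C := if k is k'.+1 then (-1) ^+ k' / k%:R else 0.

Lemma vge_plog u e : 0 < e -> vge u e -> vge (novser logcoef u e) e.
Proof.
move=> e0 ue; have := novser_approx logcoef 1 e0 ue.
by rewrite /psum big_ord1 rmorph0 mul0r subr0 mul1r.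
Qed.

Lemma dq_plog u e : 0 < e -> vge u e -> (1 + u) * dq (novser logcoef u e) = dq u.
Proof.
move=> e0 ue; rewrite dq_novser // mulrA.
have -> : derive_coef logcoef = altcoef.
  apply/funext => k; rewrite /derive_coef /= mulrC divfK // pnatr_eq0 //.
by rewrite geometricE // mul1r.
Qed.

Lemma dq_eq0 x : dq x = 0 -> x = nconst (x 0).
Proof.
move=> dx; apply: novikov_eqP => d; have [->|d0] := eqVneq d 0; first by rewrite cst_coef0.
rewrite cst_coefn //; move/(congr1 (fun z : L => z d)): dx; rewrite dqE Defs.coef0 => /eqP.
by rewrite mulf_eq0 eq_complex /= (negbTE d0) /= => /eqP.
Qed.

(** The formal logarithm inverts the exponential: both sides satisfy the same
    first-order linear equation for q d/dq and have the same constant term. *)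
Lemma pexp_plog u e : 0 < e -> vge u e -> pexp (novser logcoef u e) e = 1 + u.
Proof.
move=> e0 ue; set l := novser _ u e; have le : vge l e := vge_plog e0 ue.
have nle := vgeN le.
have F1 : pexp (- l) e * (1 + u) = 1.
  have D0 : dq (pexp (- l) e * (1 + u)) = 0.
    rewrite dqM raddfD /= [dq 1](_ : _ = 0); last by rewrite -(rmorph1 (@nconst R)) dq_cst.
    rewrite (dq_pexp e0 nle) raddfN /= add0r -(dq_plog e0 ue) -/l.
    by move: (pexp _ _) (dq l) => *; ring.
  have u1 : vge (1 + u) 0 by apply: vgeD (vge1 R) (vgeW ue _); exact: ltW.
  have := coefM_lead (vge_novser invfact e0 nle) u1.
  rewrite addr0 (novser_coef0 _ e0 nle) Defs.coefD (vge_coef0 ue e0) addr0 -qpow0 qpow_coef.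
  by rewrite /invfact invr1 mulr1 => F0; rewrite (dq_eq0 D0) F0 rmorph1.
have E := pexpD e0 le nle; rewrite subrr (pexp0 e0) in E.
by rewrite -[LHS]mulr1 -[in X in X = _]F1 mulrA -E mul1r.
Qed.

(** ** The exponential on elements of nonnegative order *)

Lemma cexp0 : cexp 0 = 1 :> C.
Proof. by rewrite /cexp /= expR0 cos0 sin0 mul1r. Qed.

Lemma novikov_exp_small h e : 0 < e -> vge h e -> novikov_exp h = pexp h e.
Proof.
by move=> e0 he; rewrite -[h in LHS]add0r -(rmorph0 (@nconst R)) (novikov_exp_cstD _ e0 he) cexp0 rmorph1 mul1r.
Qed.

Lemma split_cst x : vge x 0 -> exists2 e, 0 < e & vge (x - nconst (x 0)) e.
Proof.
move=> x0; apply: vge_gap; first by apply: vgeB x0 (vge_cst _).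
by rewrite nov_coefB cst_coef0 subrr.
Qed.

Lemma novikov_expD x h e : vge x 0 -> 0 < e -> vge h e ->
  novikov_exp (x + h) = novikov_exp x * novikov_exp h.
Proof.
move=> x0 e0 he; have [a a0 xa] := split_cst x0.
pose b := Num.min a e; have b0 : 0 < b by rewrite lt_min a0.
have xb : vge (x - nconst (x 0)) b by apply: vgeW xa _; rewrite ge_min lexx.
have hb : vge h b by apply: vgeW he _; rewrite ge_min lexx orbT.
set u := x - _ in xb; have xE : x = nconst (x 0) + u by rewrite addrC subrK.
have xhE : x + h = nconst (x 0) + (u + h) by rewrite addrA -xE.
rewrite xhE (novikov_exp_small b0 hb) (novikov_exp_cstD _ b0 (vgeD xb hb)) (pexpD b0 xb hb).
by rewrite mulrA -(novikov_exp_cstD _ b0 xb) -xE.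
Qed.

Lemma vge_novikov_exp x : vge x 0 -> vge (novikov_exp x) 0.
Proof. by move=> /vgeP x0; apply/vgeP/novikov_exp_ge0. Qed.

Lemma novikov_exp_coef0 x : vge x 0 -> novikov_exp x 0 != 0.
Proof.
move=> x0; have [e e0 xe] := split_cst x0.
rewrite -(subrK (nconst (x 0)) x) addrC (novikov_exp_cstD _ e0) // coefM_cst.
by rewrite novser_coef0 // /invfact invr1 mulr1 cexp_neq0.
Qed.

(** The remainder is quadratic in [h], uniformly: this is what makes the
    valuative partial derivative of the potential computable. *)
Lemma novikov_exp_quad h e : 0 < e -> vge h e ->
  exists2 s, vge s 0 & novikov_exp h = 1 + h + h ^+ 2 * s.
Proof.
move=> e0 he; pose c k := invfact k.+2.
exists (novser c h e); first exact: vge_novser.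
rewrite (novikov_exp_small e0 he); apply: (vge_eq e0) => M.
have -> : pexp h e - (1 + h + h ^+ 2 * novser c h e) =
  (pexp h e - psum invfact h M.+2) - h ^+ 2 * (novser c h e - psum c h M).
  have -> : psum invfact h M.+2 = 1 + h + h ^+ 2 * psum c h M.
    rewrite /psum !big_ord_recl /= /bump /= /invfact invr1 rmorph1 expr0 expr1 !mul1r addrA.
    congr (_ + _); rewrite mulr_sumr; apply: eq_bigr => k _.
    by rewrite /c !add1n !exprS; move: (nconst _) (h ^+ k) => *; ring.
  by move: (pexp h e) (novser c h e) (psum c h M) => *; ring.
apply: vgeB.
  by apply: vgeW (novser_approx _ _ e0 he) _; rewrite ler_pM2r // ler_nat leqW.
apply: vgeW (vgeM (vgeX 2 he) (novser_approx c M e0 he)) _.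
by rewrite lerDr mulr_ge0 // ltW.
Qed.

(** The constant term is the exponential of a complex number, and the remaining
    factor [1 + u] is the exponential of its formal logarithm. *)
Lemma novikov_exp_surj y (r : R) : vge y 0 -> y 0 = r%:C -> r != 0 ->
  exists2 x, vge x 0 & novikov_exp x = y.
Proof.
move=> y0 yr r0; have [c cr] := cexp_surj_real r0.
have rC : r%:C != 0 :> C by rewrite eq_complex /= (negbTE r0).
pose u := nconst (r%:C^-1) * y - 1.
have [e e0 ue] : exists2 e, 0 < e & vge u e.
  apply: vge_gap.
    by apply: vgeB (vge1 R); have := vgeM (vge_cst (r%:C^-1)) y0; rewrite addr0.
  by rewrite nov_coefB coefM_cst yr mulVf // -qpow0 qpow_coef subrr.
have le := vge_plog e0 ue.
exists (nconst c + novser logcoef u e).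
  by apply: vgeD (vge_cst _) (vgeW le _); exact: ltW.
rewrite (novikov_exp_cstD _ e0) // cr pexp_plog // /u addrC subrK mulrA -rmorphM mulfV //.
by rewrite rmorph1 mul1r.
Qed.

End NovikovExp.

(** * Tropical linear algebra *)

Section LevelSpanned.
Variables (R : realType) (n : nat) (I : finType) (e : I -> 'rV[R]_n).
Local Notation C := R[i].
Local Notation L := (novikov R).

(** Dually: no linear form attains the least weight, among the vectors where it
    does not vanish, only once.  This says that [w] lies in the tropicalization
    of the space of linear relations between the vectors. *)
Definition level_spanned (w : I -> R) : Prop :=
  forall i, (e i <= \sum_(j | (j != i) && (w j <= w i)%R) <<e j>>)%MS.

Lemma sum_genmx_coefs (A : pred I) (v : 'rV[R]_n) :
  (v <= \sum_(j | A j) <<e j>>)%MS ->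
  exists r : I -> R, (forall j, ~~ A j -> r j = 0) /\ v = \sum_j r j *: e j.
Proof.
move=> /sub_sumsmxP[u ->].
have /choice[r rP] : forall j, exists a, u j *m <<e j>>%MS = a *: e j.
  move=> j; apply/sub_rVP; apply: submx_trans (submxMl _ _) _.
  by rewrite genmxE.
exists (fun j => if A j then r j else 0); split=> [j /negbTE -> //|].
rewrite [RHS](bigID A) /= [X in _ + X]big1 ?addr0; last first.
  by move=> j /negbTE ->; rewrite scale0r.
by apply: eq_bigr => j Aj; rewrite Aj.
Qed.

Lemma exists_nonroot (p : {poly R}) : p != 0 -> exists t, ~~ root p t.
Proof.
move=> p0; apply: contrapT => h.
have allr : all (root p) [seq (k%:R : R) | k <- iota 0 (size p)].
  by apply/allP => x _; apply: contrapT => /negP rx; apply: h; exists x.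
have := max_poly_roots p0 allr; rewrite size_map size_iota ltnn map_inj_uniq ?iota_uniq.
  by move=> /(_ isT).
by move=> a b /eqP; rewrite eqr_nat => /eqP.
Qed.

(** Evaluated on the moment curve, each of the linear forms is a nonzero
    polynomial. *)
Lemma generic_vector (M : I -> I -> R) : (forall j, exists i, M j i != 0) ->
  exists c : I -> R, forall j, \sum_i M j i * c i != 0.
Proof.
move=> M0; pose p j : {poly R} := \sum_i M j i *: 'X^(enum_rank i).
have pc j i : (p j)`_(enum_rank i) = M j i.
  rewrite /p coef_sum (bigD1 i) //= coefZ coefXn eqxx mulr1 big1 ?addr0 // => k ki.
  by rewrite coefZ coefXn (inj_eq val_inj) (inj_eq enum_rank_inj) eq_sym (negbTE ki) mulr0.
have [t tr] : exists t, ~~ root (\prod_j p j) t.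
  apply: exists_nonroot; apply/prodf_neq0 => j _.
  have [i Mi] := M0 j; apply: contraNneq Mi => pj0.
  by rewrite -pc pj0 poly.coef0.
exists (fun i => t ^+ enum_rank i) => j; apply: contraNneq tr => s0.
rewrite /root horner_prod (bigD1 j) //= [X in X * _](_ : _ = 0) ?mul0r //.
rewrite /p horner_sum -[RHS]s0; apply: eq_bigr => i _.
by rewrite hornerZ hornerXn.
Qed.

(** Superpose the relations expressing the vectors through others of no larger
    weight; generic coefficients prevent cancellation of leading terms. *)
Lemma level_spanned_solution (w : I -> R) : level_spanned w ->
  exists z : I -> L,
    [/\ forall i, vge (z i) (w i),
        forall i, exists2 r : R, z i (w i) = r%:C & r != 0
      & forall k, \sum_i nconst ((e i 0 k)%:C) * z i = 0].
Proof.
move=> sp; have /choice[r rP] := fun i => sum_genmx_coefs (sp i).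
pose s i j := (j == i)%:R - r i j.
have rii i : r i i = 0 by apply: (proj1 (rP i)); rewrite eqxx.
have s_le i j : s i j != 0 -> w j <= w i.
  rewrite /s; have [->//|ji] := eqVneq j i; rewrite sub0r oppr_eq0.
  by apply: contra_neqT => wji; apply: (proj1 (rP i)); rewrite (negbTE wji) andbF.
have s_rel i : \sum_j s i j *: e j = 0.
  under eq_bigr do rewrite scalerBl; rewrite sumrB -(proj2 (rP i)).
  rewrite (bigD1 i) //= eqxx scale1r big1 ?addr0 ?subrr // => j /negbTE ->.
  by rewrite scale0r.
have [c cP] : exists c : I -> R, forall j, \sum_i ((w i == w j)%:R * s i j) * c i != 0.
  apply: generic_vector => j; exists j.
  by rewrite /s rii !eqxx subr0 mulr1 oner_neq0.
exists (fun j => \sum_i nconst ((c i * s i j)%:C) * qpow (w i)); split.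
- move=> j; apply: vge_sum => i _; have [->|/s_le wji] := eqVneq (s i j) 0.
    by rewrite mulr0 rmorph0 mul0r vge0.
  have := vgeM (vge_cst ((c i * s i j)%:C)) (vge_qpow (w i)).
  by rewrite add0r => H; exact: vgeW H wji.
- move=> j; exists (\sum_i ((w i == w j)%:R * s i j) * c i) => //.
  rewrite nov_coef_sum rmorph_sum; apply: eq_bigr => i _.
  rewrite coefM_cst /= /qpow_fun eq_sym !rmorphM rmorph_nat /=.
  ring.
- move=> k; under eq_bigr do rewrite mulr_sumr.
  rewrite exchange_big /= big1 // => i _.
  under eq_bigr do rewrite mulrA -rmorphM -rmorphM.
  rewrite -mulr_suml -rmorph_sum -rmorph_sum /=.
  rewrite [X in nconst (X%:C)](_ : _ = 0) ?rmorph0 ?mul0r //.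
  transitivity (c i * (\sum_j s i j *: e j) 0 k); last by rewrite s_rel mxE mulr0.
  rewrite summxE mulr_sumr; apply: eq_bigr => j _; rewrite !mxE; ring.
Qed.

(** A linear form vanishing on all vectors of weight at most [w i] except the
    i-th would leave a single nonzero contribution in order [w i]. *)
Lemma solution_level_spanned (w : I -> R) (z : I -> L) :
  (forall i, vge (z i) (w i)) -> (forall i, z i (w i) != 0) ->
  (forall k, \sum_i nconst ((e i 0 k)%:C) * z i = 0) -> level_spanned w.
Proof.
move=> zv z0 zr i; set A := (\sum_(j | _) _)%MS; rewrite submxE; apply: contraT.
move=> /matrix0Pn[a [k]]; rewrite (ord1 a) => ck.
pose c l := cokermx A l k.
have formE j : (e j *m cokermx A) 0 k = \sum_l c l * e j 0 l.
  by rewrite mxE; apply: eq_bigr => l _; rewrite mulrC.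
have vanish j : (j != i) && (w j <= w i) -> \sum_l c l * e j 0 l = 0.
  move=> ji; rewrite -formE (_ : e j *m _ = 0) ?mxE //; apply/eqP; rewrite -submxE.
  by apply: (sumsmx_sup j) => //; rewrite genmxE.
have formM j : (\sum_l nconst ((c l)%:C) * (nconst ((e j 0 l)%:C) * z j)) (w i) =
    (\sum_l c l * e j 0 l)%:C * z j (w i).
  under eq_bigr do rewrite mulrA -rmorphM -rmorphM.
  by rewrite -mulr_suml -!rmorph_sum coefM_cst.
have : (\sum_l nconst ((c l)%:C) * \sum_j nconst ((e j 0 l)%:C) * z j) (w i) = 0.
  by under eq_bigr do rewrite zr mulr0; rewrite big1_eq.
under eq_bigr do rewrite mulr_sumr.
rewrite exchange_big /= nov_coef_sum; under eq_bigr do rewrite formM.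
rewrite (bigD1 i) //= [X in _ + X]big1 ?addr0 => [/eqP|j ji].
  rewrite mulf_eq0 (negbTE (z0 i)) orbF eq_complex /= eqxx andbT -formE.
  by rewrite (negbTE ck).
have [wji|wij] := leP (w j) (w i); last by rewrite (vge_coef0 (zv j) wij) mulr0.
by rewrite vanish ?ji // rmorph0 mul0r.
Qed.

End LevelSpanned.

(** * Critical points of the potential *)

Section Criterion.
Variables (R : realType) (n : nat).
Local Notation C := R[i].
Local Notation L := (novikov R).

Definition real_conormal (P : ineqs R n) (i : 'I_(nineq P)) : 'rV[R]_n :=
  map_mx intr (conormal i).

Lemma pairing_shift (A : comNzRingType) (eta : 'rV[int]_n) (beta : 'rV[A]_n) j (h : A) :
  pairing eta (beta + h *: delta_mx 0 j) = pairing eta beta + (eta 0 j)%:~R * h.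
Proof.
rewrite /pairing; under eq_bigr do rewrite !mxE mulrDr.
rewrite big_split /=; congr (_ + _); rewrite (bigD1 j) //= !eqxx mulr1 big1 ?addr0 // => k kj.
by rewrite (negbTE kj) ?andbF !mulr0.
Qed.

Lemma vge_int (m : int) : vge (m%:~R : L) 0.
Proof. by rewrite -(rmorph_int (@nconst R)); exact: vge_cst. Qed.

Lemma vge_pairing (eta : 'rV[int]_n) (v : 'rV[L]_n) :
  in_Lambda0 v -> vge (pairing eta v) 0.
Proof.
move=> v0; apply: vge_sum => k _; have /vgeP vk := v0 k.
by have := vgeM (vge_int (eta 0 k)) vk; rewrite addr0.
Qed.

Variables (P : ineqs R n) (x : 'rV[R]_n) (alpha : 'rV[L]_(nineq P)) (beta : 'rV[L]_n).
Hypotheses (alpha0 : in_Lambda0 alpha) (beta0 : in_Lambda0 beta).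

Definition expterm (i : 'I_(nineq P)) : L :=
  novikov_exp (pairing (conormal i) beta + alpha 0 i).

Definition gradient (j : 'I_n) : L :=
  \sum_i (conormal i 0 j)%:~R * (expterm i * qpow (ineq i x)).

Lemma exparg_vge (i : 'I_(nineq P)) : vge (pairing (conormal i) beta + alpha 0 i) 0.
Proof. by apply: vgeD; [exact: vge_pairing|apply/vgeP/alpha0]. Qed.

Definition low_order : R := \big[Num.min/0]_(i < nineq P) ineq i x.

Lemma potential_expansion j (h : L) (e : R) : 0 < e -> vge h e ->
  exists2 r : L, vge r low_order &
    potential x alpha (beta + h *: delta_mx 0 j) - potential x alpha beta
    = h * gradient j + h ^+ 2 * r.
Proof.
move=> e0 he.
have /choice[s sP] : forall i : 'I_(nineq P), exists s : L, vge s 0 /\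
    novikov_exp ((conormal i 0 j)%:~R * h) =
    1 + (conormal i 0 j)%:~R * h + ((conormal i 0 j)%:~R * h) ^+ 2 * s.
  move=> i; have := vgeM (vge_int (conormal i 0 j)) he; rewrite add0r => mh.
  by have [s s0 sE] := novikov_exp_quad e0 mh; exists s.
exists (\sum_i expterm i * (conormal i 0 j)%:~R ^+ 2 * s i * qpow (ineq i x)).
  apply: vge_sum => i _.
  have s0 := (sP i).1.
  have y0 : vge (expterm i) 0 by apply/vge_novikov_exp/exparg_vge.
  have := vgeM (vgeM (vgeM y0 (vgeX 2 (vge_int (conormal i 0 j)))) s0) (vge_qpow (ineq i x)).
  by rewrite mulr0 !add0r => H; apply: vgeW H _; apply: bigmin_le.
rewrite /potential /gradient !mulr_sumr -sumrB -big_split /=; apply: eq_bigr => i _.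
have mh : vge ((conormal i 0 j)%:~R * h) e.
  by have := vgeM (vge_int (conormal i 0 j)) he; rewrite add0r.
rewrite pairing_shift addrAC (novikov_expD (exparg_vge i) e0 mh) (sP i).2 -/(expterm i).
by move: (expterm i) (_%:~R) (s i) (qpow _) => *; ring.
Qed.

(** For an increment [h = q^k] with [k] large the leading term of
    [h * gradient j] cannot be cancelled by the quadratic remainder. *)
Lemma critical_gradient : critical_point (potential x alpha) beta <-> forall j, gradient j = 0.
Proof.
split=> [[_ crit] j|grad0].
  apply/eqP; apply/negPn/negP => G0; have [d Gd Gv] := vge_min G0.
  have [K KP] := crit j (d + 1).
  pose k := Num.max 1 (Num.max K (d - low_order + 1)).
  have k1 : 0 < k by rewrite lt_max ltr01.
  have kK : K <= k by rewrite !le_max lexx orbT.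
  have kd : d - low_order < k by rewrite !lt_max ltrDl ltr01 !orbT.
  have hv := vge_qpow k.
  have h0 : qpow k != 0 :> L.
    apply/eqP => /(congr1 (fun y : L => y k)); rewrite qpow_coef Defs.coef0.
    exact/eqP/oner_neq0.
  have vq : valuation (qpow k : L) = k%:E.
    by apply: valuation_eq => //; rewrite qpow_coef oner_neq0.
  have := KP (qpow k); rewrite vq !lee_fin (ltW k1) kK h0 => /(_ isT isT isT).
  rewrite -EFinD mulr0 subr0 => /vgeP.
  have [r rv ->] := potential_expansion j k1 hv => Zv.
  have := vge_coef0 (d := k + d) Zv; rewrite addrA ltrDl ltr01 => /(_ isT).
  rewrite Defs.coefD (coefM_lead hv Gv) qpow_coef mul1r.
  rewrite (vge_coef0 (vgeM (vgeX 2 hv) rv)); last by lra.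
  by rewrite addr0 => Gd0; rewrite Gd0 eqxx in Gd.
split=> // j E; exists (Num.max 1 (E - low_order)) => h h0 hK hn0.
have [k hk hv] := vge_min hn0.
have vh := valuation_eq hk hv; rewrite vh in hK *.
rewrite lee_fin in hK.
have k1 : 0 < k by apply: lt_le_trans hK; rewrite lt_max ltr01.
have kE : E - low_order <= k by apply: le_trans hK; rewrite le_max lexx orbT.
rewrite -EFinD mulr0 subr0; apply/vgeP.
have [r rv ->] := potential_expansion j k1 hv.
rewrite grad0 mulr0 add0r; apply: vgeW (vgeM (vgeX 2 hv) rv) _.
lra.
Qed.

End Criterion.

Section HasCriticalPoint.
Variables (R : realType) (n : nat) (P : ineqs R n) (x : 'rV[R]_n).
Local Notation L := (novikov R).

Lemma conormal_const (i : 'I_(nineq P)) k :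
  nconst ((real_conormal i 0 k)%:C) = (conormal i 0 k)%:~R :> L.
Proof. by rewrite mxE !rmorph_int. Qed.

(** As [alpha] is free, the exponentials can be prescribed arbitrarily among
    series with nonzero real constant term, already for [beta = 0]. *)
Theorem has_critical_point_level :
  has_critical_point P x <-> level_spanned (@real_conormal R n P) (fun i => ineq i x).
Proof.
split=> [[alpha alpha0 [beta crit]]|/level_spanned_solution[z [zv z0 zr]]].
  have beta0 := crit.1; move/(critical_gradient x alpha0 beta0): crit => grad0.
  have yv i : vge (expterm alpha beta i) 0 by apply/vge_novikov_exp/exparg_vge.
  apply: (solution_level_spanned (z := fun i => expterm alpha beta i * qpow (ineq i x))).
  - by move=> i; have := vgeM (yv i) (vge_qpow (ineq i x)); rewrite add0r.
  - move=> i; rewrite coefM_qpow subrr; apply: novikov_exp_coef0.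
    exact: exparg_vge.
  - by move=> k; rewrite -[RHS](grad0 k); apply: eq_bigr => i _; rewrite conormal_const.
pose y i : L := z i * qpow (- ineq i x).
have /choice[a aP] : forall i, exists a : L, vge a 0 /\ novikov_exp a = y i.
  move=> i; have [r zi r0] := z0 i.
  have yv : vge (y i) 0 by have := vgeM (zv i) (vge_qpow (- ineq i x)); rewrite subrr.
  have yr : y i 0 = r%:C by rewrite coefM_qpow opprK add0r.
  by have [a av aE] := novikov_exp_surj yv yr r0; exists a.
pose alpha : 'rV[L]_(nineq P) := \row_i a i.
have alpha0 : in_Lambda0 alpha by move=> i; rewrite mxE; apply/vgeP; exact: (aP i).1.
have beta0 : in_Lambda0 (0 : 'rV[L]_n) by move=> i; rewrite mxE; apply/vgeP/vge0.
exists alpha => //; exists 0; apply/(critical_gradient x alpha0 beta0) => j.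
rewrite -[RHS](zr j); apply: eq_bigr => i _; rewrite conormal_const; congr (_ * _).
rewrite /expterm [pairing _ _](_ : _ = 0); last first.
  by rewrite /pairing big1 // => k _; rewrite mxE mulr0.
by rewrite add0r mxE (aP i).2 -mulrA qpowD addNr qpow0 mulr1.
Qed.

End HasCriticalPoint.

(** * Integral linear programming on a smooth polytope *)

Section Pairing.
Variables (R : realType) (n : nat).
Implicit Types (eta : 'rV[int]_n) (x y w : 'rV[R]_n).

Lemma pairingE eta x : pairing eta x = (map_mx intr eta *m x^T) 0 0.
Proof. by rewrite mxE; apply: eq_bigr => j _; rewrite !mxE. Qed.

Lemma pairingDr eta x y : pairing eta (x + y) = pairing eta x + pairing eta y.
Proof. by rewrite !pairingE linearD mulmxDr mxE. Qed.

Lemma pairingZr eta t x : pairing eta (t *: x) = t * pairing eta x.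
Proof. by rewrite !pairingE linearZ -scalemxAr mxE. Qed.

Lemma pairingNr eta x : pairing eta (- x) = - pairing eta x.
Proof. by rewrite -scaleN1r pairingZr mulN1r. Qed.

Lemma pairingBr eta x y : pairing eta (x - y) = pairing eta x - pairing eta y.
Proof. by rewrite pairingDr pairingNr. Qed.

Lemma pairing_suml (I : finType) (P : pred I) (e : I -> 'rV[int]_n) (r : I -> R) eta x :
  map_mx intr eta = \sum_(i | P i) r i *: map_mx intr (e i) ->
  pairing eta x = \sum_(i | P i) r i * pairing (e i) x.
Proof.
move=> E; rewrite pairingE E mulmx_suml summxE; apply: eq_bigr => i _.
by rewrite pairingE -scalemxAl mxE.
Qed.

Lemma ellD eta (k : R) x w : ell eta k (x + w) = ell eta k x + pairing eta w.
Proof. by rewrite /ell pairingDr addrAC. Qed.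

Lemma ell_line eta (k : R) x w t : ell eta k (x + t *: w) = ell eta k x + t * pairing eta w.
Proof. by rewrite ellD pairingZr. Qed.

Lemma ell_sub eta (k : R) x y : ell eta k x - ell eta k y = pairing eta (x - y).
Proof. by rewrite /ell pairingBr opprD addrACA subrr addr0. Qed.

(** Up to sign, a column of the cokernel of the span. *)
Lemma separating_vector (I : finType) (A : pred I) (e : I -> 'rV[int]_n) eta :
  ~~ (map_mx (intr : int -> R) eta <= \sum_(i | A i) <<map_mx intr (e i)>>)%MS ->
  exists w : 'rV[R]_n, pairing eta w < 0 /\ forall i, A i -> pairing (e i) w = 0.
Proof.
set S := (\sum_(i | _) _)%MS; rewrite submxE => /matrix0Pn[a [k]]; rewrite (ord1 a) => ck.
pose w := (col k (cokermx S))^T.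
have wE (v : 'rV[int]_n) : pairing v w = (map_mx intr v *m cokermx S) 0 k.
  by rewrite mxE; apply: eq_bigr => j _; rewrite !mxE.
have w0 i : A i -> pairing (e i) w = 0.
  move=> Ai; rewrite wE (_ : _ *m _ = 0) ?mxE //; apply/eqP; rewrite -submxE.
  by apply: (sumsmx_sup i) => //; rewrite genmxE.
rewrite -wE in ck; have [lt|gt|eq0] := ltgtP (pairing eta w) 0.
- by exists w.
- by exists (- w); rewrite pairingNr oppr_lt0; split=> // i /w0; rewrite pairingNr => ->; rewrite oppr0.
- by rewrite eq0 eqxx in ck.
Qed.

(** A maximal affinely independent family of points of [f] based at [x0]. *)
Lemma has_dim_exists (f : set 'rV[R]_n) x0 : f x0 ->
  exists2 d, has_dim f d & (d <= n)%N.
Proof.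
move=> fx0.
pose Q d := `[< exists B : 'M[R]_(d, n), row_free B /\ forall i, f (x0 + row i B) >].
have Qle d : Q d -> (d <= n)%N.
  by move=> /asboolP[B [Bfree _]]; move: Bfree; rewrite /row_free => /eqP <-; exact: rank_leq_col.
have Q0 : exists d, Q d.
  exists 0%N; apply/asboolP; exists 0; split; last by case.
  by rewrite /row_free mxrank0.
have [d Qd dmax] := ex_maxnP Q0 Qle.
exists d; last exact: Qle.
have /asboolP[B [Bfree Bf]] := Qd.
exists x0, B; split=> // y fy; apply: contraT => yB.
have : Q (d + 1)%N; last by move=> /dmax; rewrite addn1 ltnn.
apply/asboolP; exists (col_mx B (y - x0)); split; last first.
  move=> i; case: (split_ordP i) => j ->; first by rewrite rowKu.
  by rewrite rowKd (ord1 j) row_id addrC subrK.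
rewrite /row_free eqn_leq rank_leq_row /= -addsmxE addn1.
have /eqP rB := Bfree; suff : (\rank B < \rank (B + (y - x0)%R))%N by rewrite rB.
by apply: rank_ltmx; rewrite ltmxE addsmxSl addsmx_sub submx_refl (negbTE yB).
Qed.

End Pairing.

Section LinearProgram.
Variables (R : realType) (n : nat) (P : ineqs R n).
Local Notation D := (polyhedron P).
Local Notation eR := (@real_conormal R n P).
Implicit Types (x y V w : 'rV[R]_n) (eta : 'rV[int]_n).

Definition tight V : {set 'I_(nineq P)} := [set i | ineq i V == 0]%SET.

Lemma ineq_line (i : 'I_(nineq P)) x w t :
  ineq i (x + t *: w) = ineq i x + t * pairing (conormal i) w.
Proof. exact: ell_line. Qed.

(** A point where the value of [eta] depends only on the set of tight
    inequalities, see [basic_value]. *)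
Definition basic eta V := D V /\
  (map_mx intr eta <= \sum_(i in tight V) <<eR i>>)%MS.

(** Following a direction that decreases [eta] while keeping the tight
    inequalities tight, one runs into a new inequality. *)
Lemma basic_below eta (b : R) x : (forall y, D y -> b <= pairing eta y) -> D x ->
  exists2 V, basic eta V & pairing eta V <= pairing eta x.
Proof.
move=> bound; have [m] := ubnP (nineq P - #|tight x|)%N; elim: m x => // m IH x le Dx.
have [sp|nsp] := boolP (map_mx intr eta <= \sum_(i in tight x) <<eR i>>)%MS.
  by exists x.
have [w [etaw w0]] := separating_vector nsp.
have [/existsP[i0 i0w]|/existsPn allge] :=
    boolP [exists i : 'I_(nineq P), pairing (conormal i) w < 0]; last first.
  pose t := (pairing eta x - b + 1) / - pairing eta w.
  have bx := bound x Dx.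
  have t0 : 0 <= t by apply: divr_ge0; lra.
  have /bound : D (x + t *: w).
    move=> i; rewrite ineq_line addr_ge0 ?Dx // mulr_ge0 //.
    by rewrite leNgt allge.
  rewrite pairingDr pairingZr /t.
  suff -> : (pairing eta x - b + 1) / - pairing eta w * pairing eta w = - (pairing eta x - b + 1).
    by move=> h; exfalso; lra.
  by field; rewrite lt_eqF.
pose F (i : 'I_(nineq P)) : R := ineq i x / - pairing (conormal i) w.
case: (@Order.TotalTheory.arg_minP _ _ _ i0 (fun i => pairing (conormal i) w < 0) F i0w) => i iw imin.
have Fge0 : 0 <= F i by apply: divr_ge0; [exact: Dx|lra].
pose x' := x + F i *: w.
have Dx' : D x'.
  move=> j; rewrite ineq_line; have [jw|jw] := ltP (pairing (conormal j) w) 0; last first.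
    by rewrite addr_ge0 ?Dx // mulr_ge0.
  have := imin j jw; rewrite {2}/F ler_pdivlMr ?oppr_gt0 //; lra.
have ti : i \in tight x'.
  by rewrite inE ineq_line /F; apply/eqP; field; rewrite lt_eqF.
have tsub : tight x \subset tight x'.
  apply/fintype.subsetP => j jx; rewrite inE ineq_line w0 // mulr0 addr0.
  by move: jx; rewrite inE.
have tix : i \notin tight x.
  by apply: contraTN iw => /w0 ->; rewrite ltxx.
have lt : (#|tight x| < #|tight x'|)%N.
  apply: proper_card; apply/properP; split=> //; by exists i.
have [|//|V Vb Vle] := IH x'.
  have lex' : (#|tight x'| <= nineq P)%N by rewrite -[X in (_ <= X)%N]card_ord max_card.
  rewrite ltnS in le; apply: leq_trans le; apply: ltn_sub2l => //.
  exact: leq_trans lt lex'.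
exists V => //; apply: le_trans Vle _.
by rewrite /x' pairingDr pairingZr gerDl mulr_ge0_le0 // ltW.
Qed.

Lemma basic_value eta V V' : basic eta V -> basic eta V' -> tight V = tight V' ->
  pairing eta V = pairing eta V'.
Proof.
move=> [_ sp] _ tE; have [r [r0 E]] := sum_genmx_coefs sp.
rewrite !(pairing_suml _ E); apply: eq_bigr => i _.
have [it|/r0 ->] := boolP (i \in tight V); last by rewrite !mul0r.
have iV : ineq i V = 0 by move: it; rewrite inE => /eqP.
have iV' : ineq i V' = 0 by move: it; rewrite tE inE => /eqP.
congr (_ * _); move: iV iV'; rewrite /ineq /ell => /eqP h /eqP h'.
by move: h h'; rewrite !addr_eq0 => /eqP -> /eqP ->.
Qed.

(** Basic points have finitely many values, so the least one is a minimum. *)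
Lemma linear_minimum eta (b : R) x : (forall y, D y -> b <= pairing eta y) -> D x ->
  exists2 V, basic eta V & forall y, D y -> pairing eta V <= pairing eta y.
Proof.
move=> bound Dx.
pose Q (T : {set 'I_(nineq P)}) := `[< exists V, basic eta V /\ tight V = T >].
have /choice[v vP] : forall T, exists V, Q T -> basic eta V /\ tight V = T.
  move=> T; have [/asboolP[V VP]|nQ] := boolP (Q T); first by exists V.
  by exists 0.
have QT V : basic eta V -> Q (tight V) by move=> bV; apply/asboolP; exists V.
have [V0 bV0 _] := basic_below bound Dx.
case: (@Order.TotalTheory.arg_minP _ _ _ _ Q (fun T => pairing eta (v T)) (QT _ bV0)) => T QTT Tmin.
exists (v T); first exact: (vP T QTT).1.
move=> y /(basic_below bound)[V bV]; apply: le_trans.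
have [bv tv] := vP _ (QT _ bV).
by rewrite (basic_value bV bv) ?tv //; apply/Tmin/QT.
Qed.

(** The inequalities that are not tight leave room for a step whose length is
    bounded in terms of their values. *)
Lemma small_step V w : D V -> (forall i, i \in tight V -> 0 <= pairing (conormal i) w) ->
  exists2 e : R, 0 < e & D (V + e *: w).
Proof.
move=> DV w0.
pose F (i : 'I_(nineq P)) : R := ineq i V / (1 + `|pairing (conormal i) w|).
have den (i : 'I_(nineq P)) : 0 < 1 + `|pairing (conormal i) w| by rewrite ltr_wpDr.
exists (\big[Num.min/1]_(i | i \notin tight V) F i).
  apply: (big_ind (fun c => 0 < c)) => // [u v u0 v0|i iV]; first by rewrite lt_min u0.
  by rewrite divr_gt0 // lt_neqAle DV andbT eq_sym; rewrite inE in iV.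
set e := \big[_/_]_(_ | _) _ => i; rewrite ineq_line.
have e0 : 0 <= e.
  apply: (big_ind (fun c => 0 <= c)) => // [u v u0 v0|j jV]; first by rewrite le_min u0.
  by rewrite divr_ge0 // ltW.
have [it|it] := boolP (i \in tight V); first by rewrite addr_ge0 ?DV // mulr_ge0 // w0.
have eF : e <= F i by apply: bigmin_le_cond.
move: eF; rewrite ler_pdivlMr // mulrDr mulr1 => eF.
have : - (e * `|pairing (conormal i) w|) <= e * pairing (conormal i) w.
  by rewrite -mulrN ler_wpM2l // lerNl -normrN ler_norm.
lra.
Qed.

(** The tight set of a point of a smooth polytope is the set of facets through
    a face, namely the face where the sum of the tight inequalities vanishes. *)
Lemma tight_extends V :
  (forall f d k, is_face D f -> has_dim f d -> (d + k = n)%N ->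
      #|facets_through P f| = k /\ extends_to_basis (facets_through P f)) ->
  D V -> extends_to_basis (tight V).
Proof.
move=> smooth DV.
pose c : 'rV[R]_n := \sum_(i in tight V) eR i.
pose f := [set x | D x /\ forall y, D y -> \sum_j c 0 j * x 0 j <= \sum_j c 0 j * y 0 j].
have cE x : \sum_j c 0 j * x 0 j = \sum_(i in tight V) ineq i x - \sum_(i in tight V) offset i.
  rewrite -sumrB; under [RHS]eq_bigr do rewrite /ineq /ell addrK.
  under [LHS]eq_bigr do rewrite /c summxE mulr_suml.
  by rewrite exchange_big; apply: eq_bigr => i _; apply: eq_bigr => j _; rewrite mxE.
have V0 : \sum_(i in tight V) ineq i V = 0.
  by rewrite big1 // => i; rewrite inE => /eqP.
have fV : f V.
  split=> // y Dy; rewrite !cE V0 lerD2r; apply: sumr_ge0 => i _; exact: Dy.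
have fE : facets_through P f = tight V.
  apply/setP => i; rewrite !inE; apply/asboolP/eqP => [/(_ V fV)//|iV x [Dx xmin]].
  have := xmin V DV; rewrite !cE V0 lerD2r => s0 /=.
  have it : i \in tight V by rewrite inE iV.
  apply/eqP; rewrite eq_le Dx andbT; apply: le_trans s0.
  by rewrite (bigD1 i it) /= lerDl; apply: sumr_ge0 => j _; exact: Dx.
have [d fd dn] := has_dim_exists fV.
have fface : is_face D f by right; exists c.
by have [_] := smooth f d (n - d)%N fface fd (subnKC dn); rewrite fE.
Qed.

(** On a smooth polytope the minimum of an integral form is certified by a
    combination of tight conormals with natural coefficients: they are part of
    a basis of the lattice, and a negative coefficient would allow decreasing
    along the dual basis vector. *)
Lemma integral_minimum eta (b : R) x :
  (forall V, D V -> extends_to_basis (tight V)) ->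
  (forall y, D y -> b <= pairing eta y) -> D x ->
  exists V (a : 'I_(nineq P) -> nat),
    [/\ D V, forall i, a i != 0%N -> ineq i V = 0,
        eta = \sum_i (a i)%:Z *: conormal i &
        forall y, D y -> pairing eta V <= pairing eta y].
Proof.
move=> ext bound Dx; have [V [DV sp] Vmin] := linear_minimum bound Dx.
have [B [s [Bu sinj Bs]]] := ext V DV.
have [r [r0 rE]] := sum_genmx_coefs sp.
pose c := eta *m invmx B.
pose dual k : 'rV[R]_n := map_mx intr (col k (invmx B))^T.
have dualE (v : 'rV[int]_n) k : pairing v (dual k) = ((v *m invmx B) 0 k)%:~R.
  by rewrite mxE rmorph_sum; apply: eq_bigr => j _; rewrite !mxE rmorphM.
have dual_tight i k : i \in tight V -> pairing (conormal i) (dual k) = (s i == k)%:R.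
  move=> it; rewrite dualE -(Bs i it) -row_mul mulmxV // mxE mxE /=.
  by rewrite eq_sym; case: eqP.
have rc i : i \in tight V -> r i = (c 0 (s i))%:~R.
  move=> it; rewrite -dualE (pairing_suml _ rE) (bigD1 i) //= dual_tight // eqxx mulr1.
  rewrite big1 ?addr0 // => j ji; have [jt|/r0->] := boolP (j \in tight V); last by rewrite mul0r.
  by rewrite dual_tight // (inj_in_eq sinj) // (negbTE ji) mulr0.
have r_ge0 i : i \in tight V -> 0 <= r i.
  move=> it; have [e e0 De] : exists2 e : R, 0 < e & D (V + e *: dual (s i)).
    by apply: small_step => // j jt; rewrite dual_tight.
  have := Vmin _ De; rewrite pairingDr pairingZr lerDl pmulr_rge0 //.
  by rewrite dualE rc.
exists V, (fun i => if i \in tight V then absz (c ord0 (s i)) else 0%N); split=> //.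
  by move=> i; case: ifP => // it _; move: it; rewrite inE => /eqP.
apply/rowP => j; apply: (@intr_inj R).
have := congr1 (fun M : 'rV[R]_n => M 0 j) rE; rewrite mxE => ->.
rewrite !summxE rmorph_sum; apply: eq_bigr => i _; rewrite mxE [eR i 0 j]mxE [in RHS]mxE rmorphM /=; congr (_ * _).
case: ifP => [it|/negbT/r0//]; have := r_ge0 i it; rewrite rc // ler0z => c0.
by rewrite gez0_abs.
Qed.

End LinearProgram.

(** * Facets and ghost facets *)

Section Facets.
Variables (R : realType) (n : nat).
Implicit Types (D F : set 'rV[R]_n) (eta : 'rV[int]_n) (u w x : 'rV[R]_n).

Lemma interior_move D u w : interior D u -> exists2 e : R, 0 < e & D (u + e *: w).
Proof.
move=> /nbhs_ballP[e /= e0 De]; pose s : R := 1 + \sum_j `|w 0 j|.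
have s0 : 0 < s by rewrite ltr_wpDr // sumr_ge0.
exists (e / s); first by rewrite divr_gt0.
apply: De; split=> // i j; rewrite (ord1 i) /ball /= !mxE opprD addNKr normrN normrM.
rewrite ger0_norm ?divr_ge0 ?(ltW e0) ?(ltW s0) // mulrAC ltr_pdivrMr // ltr_pM2l //.
rewrite /s (bigD1 j) //= addrCA ltrDl ltr_wpDr // sumr_ge0 // => k _.
Qed.

Lemma ell_interior_gt0 D u eta (k : R) : interior D u -> eta != 0 ->
  (forall x, D x -> 0 <= ell eta k x) -> 0 < ell eta k u.
Proof.
move=> intu /matrix0Pn[i [j]]; rewrite (ord1 i) => etaj nonneg.
have [e e0 De] := interior_move (- map_mx intr eta) intu.
have := nonneg _ De; rewrite ell_line pairingNr mulrN subr_ge0; apply: lt_le_trans.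
rewrite mulr_gt0 // /pairing (bigD1 j) //= ltr_pwDl //.
  by rewrite mxE -expr2 exprn_even_gt0 //= intr_eq0.
by apply: sumr_ge0 => l _; rewrite mxE -expr2 sqr_ge0.
Qed.

Lemma map_intr_inj eta eta' : map_mx (intr : int -> R) eta = map_mx intr eta' -> eta = eta'.
Proof.
move=> E; apply/rowP => j; apply: (@intr_inj R).
by have := congr1 (fun M : 'rV[R]_n => M 0 j) E; rewrite !mxE.
Qed.

Lemma primitive_neq0 eta : primitive eta -> eta != 0.
Proof. by move=> prim; apply/eqP => eta0; have h : absz 2 = 1%N; [apply: prim => j; rewrite eta0 mxE dvdz0|]. Qed.

(** The ratio [t] is rational.  Its reduced denominator divides all entries of
    the first vector, and its reduced numerator all entries of the second. *)
Lemma primitive_parallel eta eta' (t : R) : primitive eta -> primitive eta' ->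
  map_mx intr eta' = t *: map_mx intr eta -> t = 1 \/ t = -1.
Proof.
move=> prim prim' E; have /matrix0Pn[i [j]] := primitive_neq0 prim; rewrite (ord1 i) => etaj.
have Ek k : (eta' 0 k)%:~R = t * (eta 0 k)%:~R :> R.
  by have := congr1 (fun M : 'rV[R]_n => M 0 k) E; rewrite !mxE.
have cross k : eta 0 j * eta' 0 k = eta' 0 j * eta 0 k.
  by apply: (@intr_inj R); rewrite !rmorphM /= !Ek; ring.
have aux (v v' : 'rV[int]_n) : primitive v -> v 0 j != 0 ->
    (forall k, v 0 j * v' 0 k = v' 0 j * v 0 k) -> v' 0 j \in dvdz (v 0 j).
  move=> pv vj vv'; pose g := gcdz (v 0 j) (v' 0 j).
  have g0 : g != 0 by rewrite gcdz_eq0 negb_and vj.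
  have [q vjE] : exists q, v 0 j = q * g by exists (divz (v 0 j) g); rewrite divzK ?dvdz_gcdl.
  have [q' vjE'] : exists q', v' 0 j = q' * g by exists (divz (v' 0 j) g); rewrite divzK ?dvdz_gcdr.
  have cop : coprimez q q'.
    have := mulz_gcdl q q' g; rewrite -vjE -vjE' -/g gez0_abs ?/g //.
    by rewrite -[RHS]mul1r => /(mulIf g0) /eqP.
  have q1 : absz q = 1%N.
    apply: pv => k; rewrite -(Gauss_dvdzr _ cop); apply/dvdzP; exists (v' 0 k).
    by apply: (mulIf g0); rewrite mulrAC -vjE' -vv' vjE; ring.
  have : (q * g %| q' * g)%Z by rewrite dvdzE !abszM q1 mul1n dvdn_mull.
  by rewrite -vjE -vjE'.
have d1 := aux _ _ prim etaj cross.
have t0 : t != 0.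
  have /matrix0Pn[i' [k]] := primitive_neq0 prim'; rewrite (ord1 i') => etak.
  by apply: contraNneq etak => t0; rewrite -(@intr_eq0 R) Ek t0 mul0r.
have etaj' : eta' 0 j != 0 by rewrite -(@intr_eq0 R) Ek mulf_neq0 // intr_eq0.
have d2 := aux _ _ prim' etaj' (fun k => esym (cross k)).
have abs_eq : `|eta' 0 j| = `|eta 0 j|.
  by apply/eqP; rewrite -!abszE eqz_nat eqn_dvd; apply/andP.
have : `|t| = 1.
  have tj : (eta 0 j)%:~R != 0 :> R by rewrite intr_eq0.
  apply: (mulIf (x := `|(eta 0 j)%:~R|)); first by rewrite normr_eq0.
  by rewrite -normrM -Ek mul1r -!intr_norm abs_eq.
by move=> /eqP; rewrite eqr_norml => /andP[/orP[/eqP ->|/eqP ->] _]; [left|right].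
Qed.

(** Both conormals annihilate the directions of [F], which span a hyperplane. *)
Lemma facet_parallel F d eta eta' (k k' : R) : has_dim F d -> d.+1 = n -> eta != 0 ->
  (forall x, F x -> ell eta k x = 0) -> (forall x, F x -> ell eta' k' x = 0) ->
  exists t : R, map_mx intr eta' = t *: map_mx intr eta.
Proof.
move=> [x0 [B [Fx0 Bfree FB _]]] dn eta0 e0 e0'.
have ker (v : 'rV[int]_n) (c : R) : (forall x, F x -> ell v c x = 0) ->
    (map_mx intr v <= kermx B^T)%MS.
  move=> v0; apply/sub_kermxP/rowP => i; rewrite [RHS]mxE.
  have := ell_sub v c (x0 + row i B) x0; rewrite v0 // v0 // subrr addrAC subrr add0r.
  rewrite pairingE => ->; rewrite !mxE; apply: eq_bigr => j _; by rewrite !mxE.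
have rker : \rank (kermx B^T) = 1%N.
  by rewrite mxrank_ker mxrank_tr (eqP Bfree) -dn subSnn.
have r1 : \rank (map_mx intr eta : 'rV[R]_n) = 1%N.
  rewrite rank_rV (_ : _ == 0 = false) //; apply: contraNF eta0 => /eqP m0.
  by apply/eqP/map_intr_inj; rewrite m0; apply/rowP => j; rewrite !mxE.
have [_] := mxrank_leqif_eq (ker _ _ e0); rewrite r1 rker eqxx => /esym/andP[_ le].
by apply/sub_rVP; apply: submx_trans le; exact: ker e0'.
Qed.

(** Parallel primitive conormals agree up to sign, and the sign is determined by
    positivity at an interior point. *)
Lemma facet_ineq_unique D F eta eta' (k k' : R) u : interior D u ->
  facet_ineq D F eta k -> facet_ineq D F eta' k' -> eta = eta' /\ k = k'.
Proof.
move=> intu [[_ [d Fd dn]] prim nonneg FE] [_ prim' nonneg' FE'].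
have F0 x : F x -> ell eta k x = 0 by rewrite FE => -[].
have F0' x : F x -> ell eta' k' x = 0 by rewrite FE' => -[].
have n0 := primitive_neq0 prim; have n0' := primitive_neq0 prim'.
have [t tE] := facet_parallel Fd dn n0 F0 F0'.
have [x0 [_ [Fx0 _ _ _]]] := Fd.
have pE y : pairing eta' y = t * pairing eta y by rewrite !pairingE tE -scalemxAl mxE.
have tell y : ell eta' k' y = t * ell eta k y.
  have := ell_sub eta' k' y x0; have := ell_sub eta k y x0.
  by rewrite (F0 _ Fx0) (F0' _ Fx0) !subr0 pE => -> ->.
have := ell_interior_gt0 intu n0' nonneg'.
have := ell_interior_gt0 intu n0 nonneg; rewrite tell => l0 tl0.
have t0 : 0 < t by move: tl0; rewrite pmulr_lgt0.
have [t1|tN1] := primitive_parallel prim prim' tE; last by rewrite tN1 oppr_gt0 ltr10 in t0.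
have etaE : eta = eta'.
  by apply: map_intr_inj; rewrite tE t1 scale1r.
split=> //; have := F0 _ Fx0; have := F0' _ Fx0; rewrite -etaE /ell => <- /addrI.
by [].
Qed.

End Facets.

Section Presentations.
Variables (R : realType) (n : nat) (D : set 'rV[R]_n) (P0 : ineqs R n).
Hypothesis geom : geometric_presentation D P0.
Hypothesis smooth : forall f d k, is_face D f -> has_dim f d -> (d + k = n)%N ->
  #|facets_through P0 f| = k /\ extends_to_basis (facets_through P0 f).
Implicit Types (eta : 'rV[int]_n) (u x y V : 'rV[R]_n).

Local Notation I0 := 'I_(nineq P0).

Lemma polyhedronE : D = polyhedron P0. Proof. by case: geom => -[]. Qed.

Lemma ineq_ge0 (i : I0) x : D x -> 0 <= ineq i x.
Proof. by rewrite polyhedronE; exact. Qed.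

Lemma geometric_facet (i : I0) : exists F, facet_ineq D F (conormal i) (offset i).
Proof.
case: geom => -[_ _ fg] ng; have [//|gh] := fg i.
by have := ng i gh.
Qed.

Lemma conormal_primitive (i : I0) : primitive (conormal i).
Proof. by have [F []] := geometric_facet i. Qed.

(** Inequalities with the same conormal that are both attained on [D] have the
    same offset, so they define the same facet. *)
Lemma geometric_conormal_inj : injective (@conormal R n P0).
Proof.
move=> i j ij; have [F fi] := geometric_facet i; have [F' fj] := geometric_facet j.
have off_le (a b : I0) G : facet_ineq D G (conormal a) (offset a) ->
    conormal a = conormal b -> offset a <= offset b.
  move=> [[_ [d [x0 [B [Fx0 _ _ _]]] _]] _ _ FE] ab.
  move: Fx0; rewrite FE => -[Dx0 /= a0]; have := ineq_ge0 b Dx0.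
  by rewrite /ineq -ab /ell; move: a0; rewrite /ell; lra.
have oij : offset i = offset j.
  by apply/eqP; rewrite eq_le (off_le _ _ _ fi ij) (off_le _ _ _ fj (esym ij)).
have FF' : F = F'.
  by case: (fi) => _ _ _ ->; case: (fj) => _ _ _ ->; rewrite ij oij.
have Ffacet : is_facet D F by case: fi.
case: geom => -[_ /(_ F Ffacet)[k [_ kuniq]] _] _.
by rewrite -(kuniq i fi) -(kuniq j) // FF'.
Qed.

Lemma has_dim_mono (F f : set 'rV[R]_n) d d' : F `<=` f -> has_dim F d -> has_dim f d' ->
  (d <= d')%N.
Proof.
move=> Ff [x0 [B [Fx0 Bfree FB _]]] [x1 [B' [_ B'free _ fB']]].
rewrite -(eqP Bfree) -(eqP B'free); apply: mxrankS; apply/row_subP => i.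
have -> : row i B = (x0 + row i B - x1) - (x0 - x1).
  by rewrite opprB addrA subrK addrC addKr.
by rewrite addmx_sub ?eqmx_opp ?fB' //; apply: Ff.
Qed.

Lemma integral_certificate eta (k : R) u : D u -> (forall y, D y -> 0 <= ell eta k y) ->
  exists V (a : I0 -> nat),
    [/\ D V, forall i, a i != 0%N -> ineq i V = 0, eta = \sum_i (a i)%:Z *: conormal i &
        forall y, ell eta k y = ell eta k V + \sum_i (a i)%:R * ineq i y].
Proof.
move=> Du nonneg.
have ext V : polyhedron P0 V -> extends_to_basis (tight P0 V).
  by apply: tight_extends; rewrite -polyhedronE.
have [||V [a [DV atight aE _]]] := integral_minimum (b := - k) (x := u) (eta := eta) ext.
- by move=> y; rewrite -polyhedronE => /nonneg; rewrite /ell addrC -lerBlDl sub0r.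
- by rewrite -polyhedronE.
exists V, a; rewrite polyhedronE; split=> // y.
have aR : map_mx intr eta = \sum_i (a i)%:R *: map_mx (intr : int -> R) (conormal i).
  apply/rowP => j; rewrite !(mxE, summxE) {1}aE summxE rmorph_sum.
  by apply: eq_bigr => i _; rewrite !mxE rmorphM.
apply/eqP; rewrite addrC -subr_eq ell_sub (pairing_suml _ aR); apply/eqP.
apply: eq_bigr => i _; have [->|ai] := eqVneq (a i) 0%N; first by rewrite !mul0r.
by rewrite -(ell_sub _ (offset i)) -/(ineq i y) -/(ineq i V) atight // subr0.
Qed.

(** A ghost conormal is a combination with positive integral coefficients of
    conormals whose inequalities are strictly smaller at every interior point:
    equality would force a single facet with coefficient one, and then the
    ghost inequality would vanish on that facet. *)
Lemma ghost_dominated eta (k : R) u : interior D u ->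
  (forall y, D y -> 0 <= ell eta k y) -> ghost_facet D eta k ->
  exists a : I0 -> nat, eta = \sum_i (a i)%:Z *: conormal i /\
    forall i, a i != 0%N -> ineq i u < ell eta k u.
Proof.
move=> intu nonneg [f [_ fdim fpos]].
have Du : D u := interior_subset intu.
have [V [a [DV atight aE ellE]]] := integral_certificate Du nonneg.
exists a; split=> // i ai; rewrite ltNge; apply/negP => le_u.
have u_gt0 (j : I0) : 0 < ineq j u.
  apply: ell_interior_gt0 intu _ _; first exact/primitive_neq0/conormal_primitive.
  by move=> x; exact: ineq_ge0.
have V0 := nonneg _ DV.
have rest0 : 0 <= \sum_(j | j != i) (a j)%:R * ineq j u.
  by apply: sumr_ge0 => j _; rewrite mulr_ge0 // ltW.
have ai1 : 1 <= (a i)%:R :> R by rewrite ler1n lt0n.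
have extra : 0 <= ((a i)%:R - 1) * ineq i u by rewrite mulr_ge0 ?subr_ge0 // ltW.
move: le_u; rewrite ellE (bigD1 i) //= => le_u.
have V00 : ell eta k V = 0 by lra.
have a1 : (a i)%:R = 1 :> R.
  have /eqP : ((a i)%:R - 1) * ineq i u = 0 by lra.
  by rewrite mulf_eq0 (gt_eqF (u_gt0 i)) orbF subr_eq0 => /eqP.
have a0 j : j != i -> (a j)%:R = 0 :> R.
  have s0 : \sum_(j | j != i) (a j)%:R * ineq j u = 0 by lra.
  move=> ji; have := psumr_eq0P (fun j _ => mulr_ge0 (ler0n R (a j)) (ltW (u_gt0 j))) s0 ji.
  by move=> /eqP; rewrite mulf_eq0 (gt_eqF (u_gt0 j)) orbF => /eqP.
have ellEi y : ell eta k y = ineq i y.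
  rewrite ellE V00 add0r (bigD1 i) //= a1 mul1r big1 ?addr0 // => j ji.
  by rewrite a0 // mul0r.
have [F [[_ [d Fd dn]] _ _ FE]] := geometric_facet i.
have Ff : F `<=` f.
  move=> x; rewrite FE => -[Dx /= i0]; apply: contrapT => nfx.
  by have := fpos x (conj Dx nfx); rewrite ellEi /ineq i0 ltxx.
case: fdim => [f0|[d' fd' lt]].
  by have [x0 [B [Fx0 _ _ _]]] := Fd; have := Ff _ Fx0; rewrite f0.
by have := has_dim_mono Ff Fd fd'; rewrite -ltnS dn => h; move: (leq_trans lt h); rewrite ltnn.
Qed.

(** A ghost conormal is a combination of facet conormals of strictly smaller
    weight.  Hence the condition at the ghost itself is automatic, and in the
    span required for a facet each ghost can be replaced by facets, none of
    which is the facet considered. *)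
Lemma level_spanned_presentation (P : ineqs R n) u : presentation D P -> interior D u ->
  level_spanned (@real_conormal R n P) (fun i => ineq i u) <->
  level_spanned (@real_conormal R n P0) (fun i => ineq i u).
Proof.
move=> pres intu; have Du : D u := interior_subset intu.
have DP : D = polyhedron P by case: pres.
have /choice[phi phiP] : forall i : I0, exists j : 'I_(nineq P),
    conormal j = conormal i /\ offset j = offset i.
  move=> i; have [F fi] := geometric_facet i.
  have Ffacet : is_facet D F by case: fi.
  case: pres => _ /(_ F Ffacet)[j [fj _]] _.
  by exists j; have [-> ->] := facet_ineq_unique intu fi fj.
have phi_inj : injective phi.
  move=> i j ij; apply: geometric_conormal_inj.
  by rewrite -(phiP i).1 -(phiP j).1 ij.
have phi_ineq i : ineq (phi i) u = ineq i u by rewrite /ineq (phiP i).1 (phiP i).2.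
have phi_real i : real_conormal (phi i) = real_conormal i by rewrite /real_conormal (phiP i).1.
have ghost j : (forall i, phi i != j) -> exists a : I0 -> nat,
    real_conormal j = \sum_i (a i)%:R *: real_conormal i /\
    forall i, a i != 0%N -> ineq i u < ineq j u.
  move=> jphi; have gh : ghost_facet D (conormal j) (offset j).
    case: (pres) => _ uniq /(_ j)[[F fj]|//]; exfalso.
    have Ffacet : is_facet D F by case: fj.
    have [k [_ kuniq]] := uniq F Ffacet.
    case: geom => -[_ /(_ F Ffacet)[i [fi _]] _] _.
    have fphi : facet_ineq D F (conormal (phi i)) (offset (phi i)).
      by rewrite (phiP i).1 (phiP i).2.
    by have := jphi i; rewrite -(kuniq j fj) -(kuniq _ fphi) eqxx.
  have [|a [aE alt]] := ghost_dominated intu _ gh.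
    by move=> y; rewrite DP; exact.
  exists a; split=> //; apply/rowP => k; rewrite !(mxE, summxE) aE summxE rmorph_sum.
  by apply: eq_bigr => i _; rewrite !mxE rmorphM.
have phi_case j : (exists i, j = phi i) \/ (forall i, phi i != j).
  have [/existsP[i /eqP ij]|/existsPn h] := boolP [exists i, phi i == j].
    by left; exists i.
  by right.
split=> sp i.
  have := sp (phi i); rewrite phi_real => /submx_trans; apply.
  apply/sumsmx_subP => j /andP[ji jle]; rewrite genmxE.
  have [[k jk]|/ghost[a [-> alt]]] := phi_case j.
    rewrite jk phi_real; apply: (sumsmx_sup k); last by rewrite genmxE.
    by rewrite -!phi_ineq -jk jle andbT; apply: contraNneq ji => ki; rewrite jk ki.
  apply: summx_sub => k _; have [->|ak] := eqVneq (a k) 0%N; first by rewrite scale0r sub0mx.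
  apply/scalemx_sub/(sumsmx_sup k); last by rewrite genmxE.
  have lt : ineq k u < ineq i u by apply: lt_le_trans (alt k ak) _; rewrite -phi_ineq.
  by rewrite (ltW lt) andbT; apply: contraTneq lt => ->; rewrite ltxx.
have [[k ->]|/[dup] iphi /ghost[a [-> alt]]] := phi_case i.
  rewrite phi_real; apply: submx_trans (sp k) _; apply/sumsmx_subP => j /andP[jk jle].
  rewrite genmxE; apply: (sumsmx_sup (phi j)); last by rewrite genmxE phi_real.
  by rewrite (inj_eq phi_inj) jk !phi_ineq.
apply: summx_sub => k _; have [->|ak] := eqVneq (a k) 0%N; first by rewrite scale0r sub0mx.
apply/scalemx_sub/(sumsmx_sup (phi k)); last by rewrite genmxE phi_real.
by rewrite iphi phi_ineq ltW // alt.
Qed.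

Lemma has_critical_point_presentation (P : ineqs R n) u : presentation D P -> interior D u ->
  has_critical_point P u <->
  level_spanned (@real_conormal R n P0) (fun i => ineq i u).
Proof.
by move=> pres intu; rewrite has_critical_point_level; exact: level_spanned_presentation.
Qed.

End Presentations.

(** * Polygons *)

Section Plane.
Variable R : realType.
Implicit Types (eta : 'rV[int]_2) (x y v w : 'rV[R]_2).

Definition cross (A : pzRingType) (v w : 'rV[A]_2) : A := v 0 0 * w 0 1 - v 0 1 * w 0 0.

Lemma sum_ord2 (A : nmodType) (F : 'I_2 -> A) : \sum_j F j = F 0 + F 1.
Proof.
by rewrite !big_ord_recl big_ord0 addr0; congr (_ + F _); apply: val_inj.
Qed.

Lemma pairing2 eta x : pairing eta x = (eta 0 0)%:~R * x 0 0 + (eta 0 1)%:~R * x 0 1.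
Proof. by rewrite /pairing sum_ord2. Qed.

Lemma rowP2 (A : Type) (v w : 'rV[A]_2) : v 0 0 = w 0 0 -> v 0 1 = w 0 1 -> v = w.
Proof.
move=> h0 h1; apply/rowP => j; have [->|] : j = 0 \/ j = 1; last 2 first.
- by [].
- by move=> ->.
by case: j => -[|[|//]] ?; [left|right]; apply: val_inj.
Qed.

Definition perp (A : pzRingType) (v : 'rV[A]_2) : 'rV[A]_2 :=
  \row_j (if j == 0 then - v 0 1 else v 0 0).

Lemma perp0 (A : pzRingType) (v : 'rV[A]_2) : perp v 0 0 = - v 0 1.
Proof. by rewrite mxE. Qed.

Lemma perp1 (A : pzRingType) (v : 'rV[A]_2) : perp v 0 1 = v 0 0.
Proof. by rewrite mxE. Qed.

Lemma pairing_perp eta eta' :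
  pairing eta (perp (map_mx intr eta')) = (cross eta' eta)%:~R :> R.
Proof. by rewrite pairing2 perp0 perp1 !mxE /cross rmorphB !rmorphM /=; ring. Qed.

Lemma row2_neq0 (A : nmodType) (v : 'rV[A]_2) : v != 0 -> v 0 0 != 0 \/ v 0 1 != 0.
Proof.
move=> v0; have [h0|] := eqVneq (v 0 0) 0; last by left.
right; apply: contraNneq v0 => h1.
by apply/eqP/rowP2; rewrite mxE.
Qed.

(** Cramer's rule. *)
Lemma cross_unique v v' w : cross v v' != 0 ->
  v 0 0 * w 0 0 + v 0 1 * w 0 1 = 0 -> v' 0 0 * w 0 0 + v' 0 1 * w 0 1 = 0 -> w = 0.
Proof.
move=> c0 h h'; apply: rowP2; rewrite mxE; apply: (mulfI c0); rewrite mulr0 /cross.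
  transitivity (v' 0 1 * (v 0 0 * w 0 0 + v 0 1 * w 0 1)
     - v 0 1 * (v' 0 0 * w 0 0 + v' 0 1 * w 0 1)); first by ring.
  by rewrite h h' !mulr0 subr0.
transitivity (v 0 0 * (v' 0 0 * w 0 0 + v' 0 1 * w 0 1)
     - v' 0 0 * (v 0 0 * w 0 0 + v 0 1 * w 0 1)); first by ring.
by rewrite h h' !mulr0 subr0.
Qed.

Lemma cross_span v v' w : cross v v' != 0 ->
  w = (cross w v' / cross v v') *: v + (cross v w / cross v v') *: v'.
Proof.
move=> c0; apply: rowP2; rewrite !mxE; move: c0; rewrite /cross => c0; by field.
Qed.

Lemma cross_eq0 v w : v != 0 -> cross v w = 0 -> exists t, w = t *: v.
Proof.
move=> /row2_neq0[v0|v1] c; [exists (w 0 0 / v 0 0)|exists (w 0 1 / v 0 1)];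
  apply: rowP2; rewrite !mxE ?divfK //.
  apply: (mulfI v0); move/eqP: c; rewrite subr_eq0 => /eqP ->; by field.
apply: (mulfI v1); move/eqP: c; rewrite subr_eq0 => /eqP <-; by field.
Qed.

Lemma orthogonal_parallel v v' w : w != 0 ->
  v 0 0 * w 0 0 + v 0 1 * w 0 1 = 0 -> v' 0 0 * w 0 0 + v' 0 1 * w 0 1 = 0 ->
  cross v v' = 0.
Proof.
by move=> w0 h h'; apply: contraNeq w0 => c0; apply/eqP/(cross_unique c0).
Qed.

Lemma finite_subsingletons (T : pointedType) (Q : finType) (S : Q -> T -> Prop) :
  (forall q a b, S q a -> S q b -> a = b) -> finite_set [set a | exists q, S q a].
Proof.
move=> uniq; have /choice[f fP] : forall q, exists a, forall b, S q b -> b = a.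
  move=> q; have [[a Sa]|nS] := pselect (exists a, S q a).
    by exists a => b Sb; apply: uniq Sb Sa.
  by exists point => b Sb; case: nS; exists b.
apply: sub_finite_set (finite_image f (@finite_finset Q setT)) => a [q Sa].
by exists q => //; rewrite (fP q a Sa).
Qed.

Lemma cross_decomposition (A : comNzRingType) (e z v : 'rV[A]_2) : cross e z = 1 ->
  v = cross e v *: z + cross v z *: e.
Proof.
move=> c1; apply: rowP2; rewrite !mxE.
  by rewrite -[LHS]mul1r -c1 /cross; ring.
by rewrite -[LHS]mul1r -c1 /cross; ring.
Qed.

Lemma primitive_unimodular (e : 'rV[int]_2) : primitive e -> exists z, cross e z = 1.
Proof.
move=> prim; have [a [b ab]] := Bezoutz (e 0 0) (e 0 1).
have g1 : gcdz (e 0 0) (e 0 1) = 1.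
  have := prim (gcdz (e 0 0) (e 0 1)) => h.
  rewrite -[LHS]gez0_abs // h // => j.
  have [->|->] : j = 0 \/ j = 1; last 2 first.
  - exact: dvdz_gcdl.
  - exact: dvdz_gcdr.
  by case: j => -[|[|//]] ?; [left|right]; apply: val_inj.
exists (\row_j (if j == 0 then - b else a)); rewrite /cross !mxE /= -g1 -ab; ring.
Qed.

(** The endpoints are the infimum and the supremum of [T], which belong to [C] as
    limits of points of [T]. *)
Lemma closed_hull (C T : set R) (B : R) : closed C -> T !=set0 ->
  (forall t, T t -> `|t| <= B) ->
  (forall t1 t2 t, T t1 -> T t2 -> t1 <= t <= t2 -> C t) ->
  exists a b, [/\ forall t, T t -> a <= t <= b, a <= b & forall t, a <= t <= b -> C t].
Proof.
move=> Cclosed T0 TB between.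
have closed_sup (C' T' : set R) : closed C' -> T' !=set0 -> has_ubound T' ->
    T' `<=` C' -> C' (sup T').
  move=> C'closed T'0 T'ub T'C'; have /closure_id -> := C'closed.
  by apply: (closure_subset T'C'); exact: closure_sup.
have TC : T `<=` C by move=> t Tt; apply: (between t t t) => //; rewrite lexx.
have Tub : has_ubound T by exists B => t /TB; apply: le_trans; exact: ler_norm.
have Tlb : has_lbound T.
  by exists (- B) => t /TB; rewrite ler_norml => /andP[].
have Csup : C (sup T) by exact: closed_sup.
have Cinf : C (inf T).
  rewrite /inf; pose C' := [set t | C (- t)].
  apply: (closed_sup C' [set - t | t in T]).
  - by apply: preimage_closed => // t _; exact: opp_continuous.
  - by have [t Tt] := T0; exists (- t), t.
  - by exists B => _ [t /TB + <-]; apply: le_trans; rewrite -normrN; exact: ler_norm.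
  - by move=> _ [t /TC Ct <-]; rewrite /C' /= opprK.
have hull t : T t -> inf T <= t <= sup T by move=> Tt; rewrite ge_inf // ub_le_sup.
exists (inf T), (sup T); split=> //.
  by have [t /hull /andP[]] := T0; exact: le_trans.
move=> t /andP[ta tb].
have [->//|ta'] := eqVneq t (inf T); have [->//|tb'] := eqVneq t (sup T).
have [t1 Tt1 lt1] : exists2 y, T y & y < t by apply: inf_lt; rewrite // lt_neqAle eq_sym ta'.
have [t2 Tt2 lt2] : exists2 y, T y & t < y by apply: sup_gt; rewrite // lt_neqAle tb'.
by apply: (between t1 t2) => //; rewrite (ltW lt1) (ltW lt2).
Qed.

End Plane.

Section Polygon.
Variables (R : realType) (D : set 'rV[R]_2) (P0 : ineqs R 2).
Hypothesis geom : geometric_presentation D P0.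
Hypothesis smooth : forall f d k, is_face D f -> has_dim f d -> (d + k = 2)%N ->
  #|facets_through P0 f| = k /\ extends_to_basis (facets_through P0 f).
Hypothesis Dcompact : compact D.
Variable x0 : 'rV[R]_2.
Hypothesis int_x0 : interior D x0.
Implicit Types (x y V w : 'rV[R]_2).

Local Notation I0 := 'I_(nineq P0).
Implicit Types (i j k l r : I0).
Local Notation eta := (@conormal R 2 P0).

Definition slope i r : int := cross (eta i) (eta r).

Lemma slopeN i j r : eta j = - eta i -> slope j r = - slope i r.
Proof. by move=> ji; rewrite /slope ji /cross !mxE; ring. Qed.

Lemma slope_opp i j : eta j = - eta i -> slope i j = 0.
Proof. by move=> ji; rewrite /slope ji /cross !mxE; ring. Qed.

Lemma slope_self i : slope i i = 0. Proof. by rewrite /slope /cross; ring. Qed.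

Lemma eta_neq0 i : eta i != 0.
Proof. exact/primitive_neq0/(conormal_primitive geom). Qed.

Lemma cross_real (v w : 'rV[int]_2) :
  cross (map_mx intr v) (map_mx intr w) = (cross v w)%:~R :> R.
Proof. by rewrite /cross !mxE rmorphB !rmorphM. Qed.

Lemma parallel_facets i j : i != j -> slope i j = 0 -> eta j = - eta i.
Proof.
move=> ij s0; have [] := @cross_eq0 R (map_mx intr (eta i)) (map_mx intr (eta j)).
- by apply/eqP => e0; have := eta_neq0 i => /eqP; apply;
    apply: (@map_intr_inj R 2); rewrite e0; apply/rowP => a; rewrite !mxE.
- by rewrite cross_real -/(slope i j) s0.
move=> t tE; have [t1|tN] := primitive_parallel (conormal_primitive geom (i:=i)) (conormal_primitive geom (i:=j)) tE.
  move: tE; rewrite t1 scale1r => /map_intr_inj /(geometric_conormal_inj geom) ji.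
  by rewrite ji eqxx in ij.
by apply: (@map_intr_inj R 2); rewrite tE tN scaleN1r; apply/rowP => a; rewrite !mxE rmorphN.
Qed.

Lemma slope_neq0 i j r : eta j = - eta i -> r != i -> r != j -> slope i r != 0.
Proof.
move=> ji ri rj; apply/eqP => s0; move/eqP: rj; apply.
apply: (geometric_conormal_inj geom); rewrite ji; apply: parallel_facets => //.
by rewrite eq_sym.
Qed.

Lemma ineq_sub i x y : ineq i x - ineq i y = pairing (eta i) (x - y).
Proof. exact: ell_sub. Qed.

Lemma ineq_interior i x : interior D x -> 0 < ineq i x.
Proof.
move=> intx; apply: ell_interior_gt0 intx (eta_neq0 i) _ => y.
exact: (ineq_ge0 geom).
Qed.

Lemma ineq_opp i j : eta j = - eta i -> forall x y, ineq i x + ineq j x = ineq i y + ineq j y.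
Proof.
move=> ji x y; apply/eqP; rewrite -subr_eq0 opprD addrACA !ineq_sub ji !pairing2 !mxE !rmorphN.
by apply/eqP; ring.
Qed.

Lemma facet_segment i : exists p w, [/\ w != 0, D p, ineq i p = 0, D (p + w) & ineq i (p + w) = 0].
Proof.
have [F [[_ [d Fd dn]] _ _ FE]] := geometric_facet geom i.
have d1 : d = 1%N by case: dn.
move: Fd; rewrite d1 => -[p [B [Fp Bfree FB _]]].
exists p, (row 0 B); move: (Fp) (FB 0); rewrite FE => -[Dp p0] [Dq q0]; split=> //.
by rewrite row_id; apply/eqP => B0; move: Bfree; rewrite /row_free B0 mxrank0.
Qed.

Lemma ineq_same_parallel i j p w : w != 0 -> ineq i p = 0 -> ineq i (p + w) = 0 ->
  ineq j p = 0 -> ineq j (p + w) = 0 -> slope i j = 0.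
Proof.
move=> w0 ip iq jp jq.
have pw a : ineq a p = 0 -> ineq a (p + w) = 0 ->
    (map_mx intr (eta a) : 'rV[R]_2) 0 0 * w 0 0 + (map_mx intr (eta a) : 'rV[R]_2) 0 1 * w 0 1 = 0.
  move=> ap aq; have := ineq_sub a (p + w) p; rewrite ap aq subrr addrAC subrr add0r pairing2.
  by rewrite !mxE.
have := orthogonal_parallel w0 (pw i ip iq) (pw j jp jq).
by rewrite cross_real => /eqP; rewrite intr_eq0 => /eqP.
Qed.

(** On the facet of [k] the other two inequalities would vanish as well, so that
    all three conormals would be parallel; but distinct parallel facets are
    opposite. *)
Lemma facet_not_between k i j (s t : R) : i != j -> k != i -> k != j -> 0 < s -> 0 < t ->
  ~ (forall y, ineq k y = s * ineq i y + t * ineq j y).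
Proof.
move=> ij ki kj s0 t0 E; have [p [w [w0 Dp kp Dq kq]]] := facet_segment k.
have zero y : D y -> ineq k y = 0 -> ineq i y = 0 /\ ineq j y = 0.
  move=> Dy; rewrite E => /eqP; have iy := ineq_ge0 geom i Dy; have jy := ineq_ge0 geom j Dy.
  rewrite paddr_eq0 ?mulr_ge0 ?(ltW s0) ?(ltW t0) // !mulf_eq0 (gt_eqF s0) (gt_eqF t0) /=.
  by move=> /andP[/eqP -> /eqP ->].
have [ip jp] := zero p Dp kp; have [iq jq] := zero _ Dq kq.
have ik := parallel_facets ki (ineq_same_parallel w0 kp kq ip iq).
have jk := parallel_facets kj (ineq_same_parallel w0 kp kq jp jq).
by move/eqP: ij; apply; apply: (geometric_conormal_inj geom); rewrite ik jk.
Qed.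

(** If three facet conormals were affinely collinear and their inequalities
    agreed at a point, the middle one would be a convex combination of the
    others. *)
Lemma triple_independent i j k x : i != j -> i != k -> j != k ->
  ineq i x = ineq j x -> ineq i x = ineq k x ->
  cross (eta i - eta j) (eta i - eta k) != 0.
Proof.
move=> ij ik jk xij xik; apply/eqP => c0.
have vE (a b : I0) : map_mx intr (eta a - eta b) = map_mx intr (eta a) - map_mx intr (eta b) :> 'rV[R]_2.
  by apply/rowP => c; rewrite !mxE rmorphB.
have [] := @cross_eq0 R (map_mx intr (eta i - eta j)) (map_mx intr (eta i - eta k)).
- apply/eqP => h; have : eta i - eta j = 0.
    by apply: (@map_intr_inj R 2); rewrite h; apply/rowP => c; rewrite !mxE.
  by move/eqP; rewrite subr_eq0 => /eqP /(geometric_conormal_inj geom) /eqP; rewrite (negbTE ij).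
- by rewrite cross_real c0.
move=> t; rewrite !vE => tE.
have diff y : ineq i y - ineq k y = t * (ineq i y - ineq j y).
  have pd (a b : I0) : ineq a x = ineq b x -> ineq a y - ineq b y =
      ((map_mx intr (eta a) - map_mx intr (eta b) : 'rV[R]_2) *m (y - x)^T) 0 0.
    move=> ab; have -> : ((map_mx intr (eta a) - map_mx intr (eta b) : 'rV[R]_2) *m (y - x)^T) 0 0
        = pairing (eta a) (y - x) - pairing (eta b) (y - x).
      by rewrite mulmxBl !pairingE; set M := _ *m _; set N := _ *m _; rewrite !mxE.
    by rewrite -!ineq_sub ab; ring.
  by rewrite (pd _ _ xij) (pd _ _ xik) tE -scalemxAl mxE.
have [t0|t0|t0] := ltgtP t 0.
- apply: (@facet_not_between i k j ((1 - t)^-1) (- t / (1 - t))); rewrite ?[k == j]eq_sym //.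
  + by rewrite invr_gt0; lra.
  + by rewrite divr_gt0; lra.
  + move=> y; have := diff y => dy; have tn : 1 - t != 0 by lra.
    have -> : ineq k y = ineq i y - t * (ineq i y - ineq j y) by lra.
    by field.
- have [t1|t1|t1] := ltgtP t 1.
  + apply: (@facet_not_between k i j (1 - t) t); rewrite ?[k == _]eq_sym //; first by lra.
    by move=> y; have := diff y; lra.
  + apply: (@facet_not_between j k i (t^-1) (1 - t^-1)); rewrite ?[k == i]eq_sym ?[j == i]eq_sym //.
    * by rewrite invr_gt0.
    * by rewrite subr_gt0 invf_lt1.
    * move=> y; have := diff y => dy; have tn : t != 0 by rewrite gt_eqF.
      have -> : ineq k y = ineq i y - t * (ineq i y - ineq j y) by lra.
      by field.
  + move: tE; rewrite t1 scale1r => /addrI/oppr_inj/map_intr_inj/(geometric_conormal_inj geom) kj.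
    by rewrite kj eqxx in jk.
- move: tE; rewrite t0 scale0r => /eqP; rewrite subr_eq0 => /eqP/map_intr_inj.
  by move/(geometric_conormal_inj geom)/eqP; rewrite (negbTE ik).
Qed.

Lemma polygon_bounded : exists B : R, forall y, D y -> forall a, `|y 0 a| <= B.
Proof.
have [M [_ MB]] := compact_bounded Dcompact.
exists (M + 1) => y Dy a; have := MB (M + 1) _ y Dy; rewrite ltrDl ltr01 => /(_ isT).
apply: le_trans; rewrite /Num.norm /= mx_normrE.
by apply: (@le_bigmax _ _ _ 0 (fun ij : 'I_1 * 'I_2 => `|y ij.1 ij.2|) (0, a)).
Qed.

Lemma polygon_bounded_below (z : 'rV[int]_2) : exists c : R, forall y, D y -> 0 <= ell z c y.
Proof.
have [B yB] := polygon_bounded.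
exists ((`|(z 0 0)%:~R| + `|(z 0 1)%:~R|) * B) => y Dy; rewrite /ell pairing2 mulrDl addrACA.
have le (a : 'I_2) : 0 <= (z 0 a)%:~R * y 0 a + `|(z 0 a)%:~R| * B.
  rewrite -lerBlDl sub0r; apply: le_trans (_ : `|(z 0 a)%:~R * y 0 a| <= _).
    by rewrite -normrN; exact: ler_norm.
  by rewrite normrM ler_wpM2l ?yB.
exact: addr_ge0.
Qed.

(** Otherwise the ray from [x0] in direction [w] would stay in the polygon. *)
Lemma exists_decreasing w : w != 0 -> exists r, pairing (eta r) w < 0.
Proof.
move=> w0; apply: contrapT => h.
have ge0 r : 0 <= pairing (eta r) w by rewrite leNgt; apply/negP => lt; apply: h; exists r.
have Dray (t : R) : 0 <= t -> D (x0 + t *: w).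
  move=> t0; rewrite (polyhedronE geom) => r; rewrite ineq_line addr_ge0 ?mulr_ge0 //.
  by apply/ltW/ineq_interior.
have [B yB] := polygon_bounded.
have [a wa] : exists a : 'I_2, w 0 a != 0 by have [] := row2_neq0 w0; [exists 0|exists 1].
have B0 : 0 <= B by apply: le_trans (yB _ (interior_subset int_x0) a).
pose t := (2 * B + 1) / `|w 0 a|.
have t0 : 0 <= t by rewrite divr_ge0 //; lra.
have := yB _ (Dray t t0) a; have := yB _ (interior_subset int_x0) a; rewrite !mxE => h1 h2.
have : `|t * w 0 a| <= 2 * B.
  have -> : t * w 0 a = (x0 0 a + t * w 0 a) - x0 0 a by ring.
  by apply: le_trans (ler_normB _ _) _; lra.
rewrite normrM (ger0_norm t0) /t divfK ?normr_eq0 //; lra.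
Qed.

(** On the middle line of two opposite facets, where these are closest, every
    facet of positive slope [a] is dominated by one of slope one.  The reason is
    a Euclidean division: there is an integral covector [z] of slope one such
    that [eta r = a z + c' eta i] with [0 <= c' < a].  The minimum of [z] on the
    polygon, attained at [V], is certified by facets through [V] of nonnegative
    slope, and as these slopes add up to one, a facet [l] of slope one occurs
    among them.  Thus the inequality of [l] is at most [z - z(V)], and comparing
    [z - z(V)] with the inequality of [r] costs at most [a - 1] times the common
    value of [i] and [j]. *)
Lemma slope_one_below i j r x : eta j = - eta i -> D x -> ineq i x = ineq j x ->
  (forall k, ineq i x <= ineq k x) -> 0 < slope i r ->
  exists l, slope i l = 1 /\
    ((slope i r)%:~R - 1) * (ineq l x - ineq i x) <= ineq r x - ineq l x.
Proof.
move=> ji Dx xij xmin; set a := slope i r => a0.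
have [z0 z01] := primitive_unimodular (conormal_primitive geom (i:=i)).
pose c := cross (eta r) z0.
pose z := z0 + divz c a *: eta i; pose c' := modz c a.
have z1 : cross (eta i) z = 1.
  by rewrite -z01 /cross /z !mxE; ring.
have rE : eta r = a *: z + c' *: eta i.
  rewrite [LHS](cross_decomposition (eta r) z01) -/c -/(slope i r) -/a /z.
  rewrite {1}(divz_eq c a) scalerDr scalerA -addrA -scalerDl; congr (_ + _ *: _).
  by rewrite mulrC.
have c'0 : 0 <= c' by rewrite modz_ge0 // gt_eqF.
have c'a : c' <= a - 1 by rewrite -ltzD1 subrK ltz_pmod.
have [k zbound] := polygon_bounded_below z.
have [V [b [DV btight zE ellE]]] := integral_certificate geom smooth Dx zbound.
have ineqV s : 0 <= ineq s V := ineq_ge0 geom s DV.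
have sum_slope : \sum_s (b s)%:Z * slope i s = 1.
  rewrite -z1 zE /cross !summxE !mulr_sumr -sumrB; apply: eq_bigr => s _.
  by rewrite /slope /cross !mxE; ring.
have no_neg u : b u != 0%N -> 0 <= slope i u.
  move=> bu; rewrite leNgt; apply/negP => su.
  have [t bt st] : exists2 t, b t != 0%N & 0 < slope i t.
    apply: contrapT => h; suff : \sum_s (b s)%:Z * slope i s <= 0 by rewrite sum_slope.
    apply: sumr_le0 => s _; have [->|bs] := eqVneq (b s) 0%N; first by rewrite mul0r.
    by rewrite mulr_ge0_le0 // leNgt; apply/negP => ss; apply: h; exists s.
  pose lam : int := cross (slope i t *: eta u - slope i u *: eta t) z.
  have lamE : slope i t *: eta u - slope i u *: eta t = lam *: eta i.
    rewrite [LHS](cross_decomposition _ z1) -/lam [X in X *: z](_ : _ = 0) ?scale0r ?add0r //.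
    by rewrite /slope /cross !mxE; ring.
  have lamR d : (slope i t)%:~R * (eta u 0 d)%:~R - (slope i u)%:~R * (eta t 0 d)%:~R
      = lam%:~R * (eta i 0 d)%:~R :> R.
    by rewrite -!intrM -intrB; have := congr1 (fun M : 'rV[int]_2 => M 0 d) lamE; rewrite !mxE => ->.
  have line y : (slope i t)%:~R * ineq u y - (slope i u)%:~R * ineq t y
      = lam%:~R * (ineq i y - ineq i V).
    have := ineq_sub u y V; rewrite (btight u bu) subr0 => ->.
    have := ineq_sub t y V; rewrite (btight t bt) subr0 => ->.
    rewrite ineq_sub !pairing2; have := lamR 0; have := lamR 1.
    move: (y - V) => v h1 h0.
    transitivity (((slope i t)%:~R * (eta u 0 0)%:~R - (slope i u)%:~R * (eta t 0 0)%:~R) * v 0 0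
      + ((slope i t)%:~R * (eta u 0 1)%:~R - (slope i u)%:~R * (eta t 0 1)%:~R) * v 0 1); first by ring.
    by rewrite h0 h1; ring.
  (* Facets through V of slopes of both signs would put the conormal of i or j
     in the cone they span, and that facet would be reduced to V. *)
  have core e (s : R) : 0 <= s -> slope e u != 0 ->
      (forall y, (slope i t)%:~R * ineq u y - (slope i u)%:~R * ineq t y
        = s * (ineq e y - ineq e V)) -> False.
    move=> s0 eu E; have [p [w [w0 Dp ep Dq eq]]] := facet_segment e.
    have u0 y : D y -> ineq e y = 0 -> ineq u y = 0.
      move=> Dy ey; have := E y; rewrite ey sub0r => Ey.
      have uy := ineq_ge0 geom u Dy; have ty := ineq_ge0 geom t Dy.
      have h1 : 0 <= - (slope i u)%:~R * ineq t y.
        by rewrite mulr_ge0 // oppr_ge0 lerz0 ltW.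
      have h2 : 0 <= s * ineq e V by rewrite mulr_ge0.
      have h3 : 0 <= (slope i t)%:~R * ineq u y by rewrite mulr_ge0 // ler0z ltW.
      have : (slope i t)%:~R * ineq u y = 0 by lra.
      by move/eqP; rewrite mulf_eq0 intr_eq0 (gt_eqF st) => /eqP.
    by move/eqP: eu; apply; apply: ineq_same_parallel w0 ep eq (u0 _ Dp ep) (u0 _ Dq eq).
  have [lam0|lam0] := lerP 0 lam.
    by apply: (core i lam%:~R) => //; [rewrite ler0z|rewrite lt_eqF].
  apply: (core j (- lam%:~R)).
  - by rewrite oppr_ge0 lerz0 // ltW.
  - by rewrite (slopeN _ ji) oppr_eq0 lt_eqF.
  - move=> y; rewrite line mulNr -mulrN; congr (_ * _).
    by have := ineq_opp ji y V; lra.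
have [l bl sl] : exists2 l, b l != 0%N & 0 < slope i l.
  apply: contrapT => h; suff : \sum_s (b s)%:Z * slope i s <= 0 by rewrite sum_slope.
  apply: sumr_le0 => s _; have [->|bs] := eqVneq (b s) 0%N; first by rewrite mul0r.
  by rewrite mulr_ge0_le0 // leNgt; apply/negP => ss; apply: h; exists s.
have sl1 : slope i l = 1.
  have le1 : (b l)%:Z * slope i l <= 1.
    rewrite -sum_slope (bigD1 l) //= lerDl; apply: sumr_ge0 => s _.
    have [->|bs] := eqVneq (b s) 0%N; first by rewrite mul0r.
    by rewrite mulr_ge0 // no_neg.
  apply/eqP; rewrite eq_le; apply/andP; split; last by [].
  apply: le_trans le1; rewrite ler_peMl ?(ltW sl) //.
  by rewrite lez_nat lt0n.
exists l; split=> //.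
pose L : R := \sum_s (b s)%:R * ineq s x.
have Lx : L = pairing z (x - V).
  by rewrite -(ell_sub z k) ellE /L; ring.
have lL : ineq l x <= L.
  rewrite /L (bigD1 l) //=; apply: le_trans (_ : (b l)%:R * ineq l x <= _).
    by rewrite ler_peMl ?(ineq_ge0 geom) // ler1n lt0n.
  by rewrite lerDl; apply: sumr_ge0 => s _; rewrite mulr_ge0 // (ineq_ge0 geom).
have aR d : (eta r 0 d)%:~R = a%:~R * (z 0 d)%:~R + c'%:~R * (eta i 0 d)%:~R :> R.
  by rewrite -!intrM -intrD; have := congr1 (fun M : 'rV[int]_2 => M 0 d) rE; rewrite !mxE => ->.
have rx : ineq r x = ineq r V + a%:~R * L + c'%:~R * (ineq i x - ineq i V).
  have -> : ineq r x = ineq r V + pairing (eta r) (x - V) by rewrite -ineq_sub; ring.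
  by rewrite Lx ineq_sub !pairing2 !aR; ring.
have iV : ineq i V <= 2 * ineq i x.
  by have := ineq_opp ji x V; have := ineqV j; rewrite -xij; lra.
have m0 : 0 <= ineq i x := ineq_ge0 geom i Dx.
have c'R0 : 0 <= c'%:~R :> R by rewrite ler0z.
have c'Ra : c'%:~R <= a%:~R - 1 :> R by rewrite -[1]/(1%:~R) -intrB ler_int.
have h1 : 0 <= c'%:~R * (2 * ineq i x - ineq i V) by rewrite mulr_ge0 ?subr_ge0.
have h2 : 0 <= (a%:~R - 1 - c'%:~R) * ineq i x by rewrite mulr_ge0 ?subr_ge0.
have a0R : 0 <= a%:~R :> R by rewrite ler0z ltW.
have h3 : 0 <= a%:~R * (L - ineq l x) by rewrite mulr_ge0 ?subr_ge0.
have := ineqV r; rewrite rx; lra.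
Qed.

(** ** Points satisfying the spanning condition *)

Definition critical x := level_spanned (@real_conormal R 2 P0) (fun i => ineq i x).

(** The condition along which the set of critical points can be
    one-dimensional: [k] and [l] agree on the whole middle line of [i] and [j].
    The inequalities are weak in order to make it closed. *)
Definition doubled i j k l x : Prop :=
  [/\ eta j = - eta i, [/\ k != i, k != j, l != i & l != j], k != l,
      slope i k = slope i l &
      [/\ ineq i x = ineq j x, ineq i x <= ineq k x, ineq k x = ineq l x &
          forall r, r != i -> r != j -> ineq k x <= ineq r x]].

Lemma doubled_swap i j k l x : doubled i j k l x -> doubled j i k l x.
Proof.
move=> [ji [ki kj li lj] kl skl [xij xik xkl kmin]].
split=> //; first by rewrite ji opprK.
  by rewrite !(slopeN _ ji) skl.
by split=> //; [rewrite -xij|move=> r rj ri; exact: kmin].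
Qed.

Lemma opposite_gt0 i j x : eta j = - eta i -> ineq i x = ineq j x -> 0 < ineq i x.
Proof.
move=> ji xij; have := ineq_opp ji x x0; rewrite -xij.
by have := ineq_interior i int_x0; have := ineq_interior j int_x0; lra.
Qed.

Lemma ineqs_gt0_interior y : (forall r, 0 < ineq r y) -> interior D y.
Proof.
move=> y0; rewrite (polyhedronE geom) /interior /=.
have near_r r : \forall z \near y, 0 < ineq r z.
  have cont : ineq r z @[z --> y] --> ineq r y.
    rewrite /ineq /ell; under eq_fun do rewrite pairing2; rewrite pairing2.
    have cz a : z 0 a @[z --> y] --> y 0 a by exact: coord_continuous.
    by apply: (cvgD (cvgD (cvgM (cvg_cst _) (cz 0)) (cvgM (cvg_cst _) (cz 1))) (cvg_cst _)).
  exact: (@cvgr_gt R _ _ _ (@ineq R 2 P0 r) (ineq r y) cont 0 (y0 r)).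
have := @filter_forall 'rV[R]_2 I0 (fun r => [set z | 0 < ineq r z]) (nbhs y) _ near_r.
by move=> /(_ (nbhs_filter y)); apply: filterS => z zr r; apply/ltW/zr.
Qed.

Lemma span_two (p q r : I0) (w : I0 -> R) : p != r -> q != r -> w p <= w r -> w q <= w r ->
  slope p q != 0 ->
  (@real_conormal R 2 P0 r <= \sum_(j | (j != r) && (w j <= w r)%R) <<@real_conormal R 2 P0 j>>)%MS.
Proof.
move=> pr qr wp wq s0.
have c0 : cross (real_conormal p) (real_conormal q) != 0 :> R.
  by rewrite cross_real intr_eq0.
rewrite (cross_span (real_conormal r) c0) addmx_sub // scalemx_sub //.
  by apply: (sumsmx_sup p); rewrite ?pr ?genmxE.
by apply: (sumsmx_sup q); rewrite ?qr ?genmxE.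
Qed.

(** The conormals of [i] and [j] span each other; together with that of [k] or
    of [l] they span the plane, and all other inequalities are at least as
    large. *)
Lemma doubled_critical i j k l x : doubled i j k l x -> critical x.
Proof.
move=> [ji [ki kj li lj] kl skl [xij xik xkl kmin]] r.
have ij : i != j.
  apply: contraTneq (eta_neq0 i) => ij; rewrite negbK.
  move: ji; rewrite -ij => h; apply/eqP/rowP => a.
  have := congr1 (fun M : 'rV[int]_2 => M 0 a) h; rewrite !mxE.
  by move/eqP; rewrite -subr_eq0 opprK -mulr2n mulrn_eq0 => /eqP.
have rji : real_conormal j = - real_conormal i :> 'rV[R]_2.
  by apply/rowP => a; rewrite !mxE ji !mxE rmorphN.
have [->|ri] := eqVneq r i.
  apply: (sumsmx_sup j); first by rewrite eq_sym ij xij lexx.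
  by rewrite genmxE rji eqmx_opp.
have [->|rj] := eqVneq r j.
  apply: (sumsmx_sup i); first by rewrite ij xij lexx.
  by rewrite genmxE rji eqmx_opp.
have kr := kmin r ri rj.
have ir : ineq i x <= ineq r x := le_trans xik kr.
have [rk|rk] := eqVneq r k.
  apply: (span_two (p := i) (q := l)) => //.
  - by rewrite eq_sym.
  - by rewrite rk eq_sym.
  - by rewrite -xkl.
  - exact: slope_neq0 ji li lj.
apply: (span_two (p := i) (q := k)) => //; try by rewrite eq_sym.
exact: slope_neq0 ji ki kj.
Qed.

Definition triple_point (q : I0 * I0 * I0) x : Prop :=
  let: (i, j, k) := q in
  [/\ i != j, i != k, j != k, ineq i x = ineq j x & ineq i x = ineq k x].

Definition crossing_point (q : I0 * I0 * (I0 * I0)) x : Prop :=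
  let: (i, j, (k, l)) := q in
  [/\ eta j = - eta i, slope i k != slope i l, ineq i x = ineq j x & ineq k x = ineq l x].

Definition exceptional x : Prop :=
  (exists q, triple_point q x) \/ (exists q, crossing_point q x).

Lemma pairing_diff i j x y : ineq i x = ineq j x -> ineq i y = ineq j y ->
  (map_mx intr (eta i - eta j) : 'rV[R]_2) 0 0 * (x - y) 0 0
  + (map_mx intr (eta i - eta j) : 'rV[R]_2) 0 1 * (x - y) 0 1 = 0.
Proof.
move=> xij yij; have : pairing (eta i) (x - y) - pairing (eta j) (x - y) = 0.
  by rewrite -!ineq_sub xij yij subrr.
by rewrite !pairing2 !mxE !rmorphB /= => h; rewrite -[RHS]h; ring.
Qed.

(** Each of the finitely many coincidences determines the point. *)
Lemma finite_exceptional : finite_set [set x | exceptional x].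
Proof.
suff : finite_set ([set x | exists q, triple_point q x] `|` [set x | exists q, crossing_point q x]).
  by apply: sub_finite_set => x [h|h]; [left|right].
rewrite finite_setU; split; apply: finite_subsingletons.
  move=> [[i j] k] x y [ij ik jk xij xik] [_ _ _ yij yik].
  have c0 : cross (map_mx intr (eta i - eta j)) (map_mx intr (eta i - eta k)) != 0 :> R.
    by rewrite cross_real intr_eq0; apply: triple_independent xij xik.
  by apply/eqP; rewrite -subr_eq0; apply/eqP/(cross_unique c0); apply: pairing_diff.
move=> [[i j] [k l]] x y [ji skl xij xkl] [_ _ yij ykl].
have c0 : cross (map_mx intr (eta i - eta j)) (map_mx intr (eta k - eta l)) != 0 :> R.
  rewrite cross_real intr_eq0 ji opprK; apply: contra skl => /eqP h; apply/eqP.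
  have : 2 * (slope i k - slope i l) = 0.
    by rewrite -h /slope /cross !mxE; ring.
  lia.
by apply/eqP; rewrite -subr_eq0; apply/eqP/(cross_unique c0); apply: pairing_diff.
Qed.

(** A facet with the smallest value needs another one of the same value; only
    one is left outside triple points, so it is parallel, hence opposite.  The
    next smallest value, at [k], must then also be attained at some [l], for the
    conormals of [i] and [j] span only a line. *)
Lemma critical_doubled x : critical x -> ~ exceptional x ->
  exists i j k l, doubled i j k l x /\ ineq i x < ineq k x.
Proof.
move=> crit nexc.
have no3 i j k : i != j -> i != k -> j != k -> ineq i x = ineq j x -> ineq i x = ineq k x -> False.
  by move=> ij ik jk xij xik; apply: nexc; left; exists (i, j, k).
have real0 i : real_conormal i != 0 :> 'rV[R]_2.
  apply/eqP => e0; have := eta_neq0 i => /eqP; apply.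
  by apply: (@map_intr_inj R 2); rewrite [LHS]e0; apply/rowP => a; rewrite !mxE.
have par (a b : I0) : (@real_conormal R 2 P0 a <= <<real_conormal b>>)%MS -> slope b a = 0.
  rewrite genmxE => /sub_rVP[t tE]; apply: (@intr_inj R).
  rewrite -cross_real -!/(real_conormal _) tE /cross !mxE; ring.
have [r0 _] : exists r, pairing (eta r) (const_mx 1 : 'rV[R]_2) < 0.
  apply: exists_decreasing; apply/eqP => /rowP/(_ 0); rewrite !mxE => /eqP.
  by rewrite oner_eq0.
case: (@Order.TotalTheory.arg_minP _ _ _ r0 xpredT (fun i => ineq i x) isT) => i _ imin.
have {}imin k : ineq i x <= ineq k x by exact: imin.
have [j ij xij] : exists2 j, j != i & ineq j x = ineq i x.
  apply: contrapT => h; have := crit i; rewrite big1 => [|j /andP[ji jle]].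
    by rewrite submx0 (negbTE (real0 i)).
  by case: h; exists j => //; apply/eqP; rewrite eq_le jle imin.
have ji : eta j = - eta i.
  suff /par s0 : (@real_conormal R 2 P0 i <= <<real_conormal j>>)%MS.
    have := parallel_facets ij s0 => ->; by rewrite opprK.
  apply: submx_trans (crit i) _; apply/sumsmx_subP => k /andP[ki kle].
  have [->//|kj] := eqVneq k j.
  have xk : ineq k x = ineq i x by apply/eqP; rewrite eq_le kle imin.
  by exfalso; apply: (no3 i j k); rewrite 1?eq_sym.
have [r1 r1dec] : exists r, pairing (eta r) (perp (map_mx intr (eta i)) : 'rV[R]_2) < 0.
  apply: exists_decreasing; apply/eqP => p0; have /eqP := eta_neq0 i; apply.
  apply: rowP2; rewrite mxE; apply: (@intr_inj R).
    by have := congr1 (fun M : 'rV[R]_2 => M 0 1) p0; rewrite perp1 !mxE.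
  have := congr1 (fun M : 'rV[R]_2 => M 0 0) p0; rewrite perp0 !mxE => /eqP.
  by rewrite oppr_eq0 => /eqP.
have r1ok : (r1 != i) && (r1 != j).
  move: r1dec; rewrite pairing_perp -/(slope i r1); apply: contraTT.
  rewrite negb_and !negbK => /orP[/eqP->|/eqP->]; first by rewrite slope_self ltxx.
  by rewrite (slope_opp ji) ltxx.
case: (@Order.TotalTheory.arg_minP _ _ _ r1 (fun r => (r != i) && (r != j)) (fun r => ineq r x) r1ok)
  => k /andP[ki kj] kmin.
have {}kmin r : r != i -> r != j -> ineq k x <= ineq r x.
  by move=> ri rj; apply: kmin; rewrite ri.
have ik : ineq i x < ineq k x.
  rewrite lt_neqAle imin andbT; apply/eqP => xik.
  by apply: (no3 i j k); rewrite 1?eq_sym.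
have [l [li lj lk] xkl] : exists2 l, [/\ l != i, l != j & l != k] & ineq k x = ineq l x.
  apply: contrapT => h; have := slope_neq0 ji ki kj; rewrite par ?eqxx //.
  apply: submx_trans (crit k) _; apply/sumsmx_subP => l /andP[lk lle].
  have [->//|li] := eqVneq l i; have [->|lj] := eqVneq l j.
    rewrite !genmxE (_ : real_conormal j = - real_conormal i) ?eqmx_opp //.
    by apply/rowP => a; rewrite !mxE ji !mxE rmorphN.
  case: h; exists l => //; apply/eqP; rewrite eq_le lle andbT; exact: kmin.
exists i, j, k, l; split=> //; split=> //; first by rewrite eq_sym.
  apply: contrapT => /eqP skl; apply: nexc; right; exists (i, j, (k, l)); by split.
Qed.

(** ** The middle line *)

Lemma ineq_between r x y (t : R) :
  ineq r ((1 - t) *: x + t *: y) = (1 - t) * ineq r x + t * ineq r y.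
Proof. by rewrite /ineq /ell pairingDr !pairingZr; ring. Qed.

Lemma midline_value i j x y : eta j = - eta i -> ineq i x = ineq j x -> ineq i y = ineq j y ->
  ineq i x = ineq i y.
Proof. by move=> ji xij yij; have := ineq_opp ji x y; rewrite -xij -yij; lra. Qed.

Lemma equal_slope_const i j k l x y : eta j = - eta i -> slope i k = slope i l ->
  ineq i x = ineq j x -> ineq i y = ineq j y ->
  ineq k x - ineq l x = ineq k y - ineq l y.
Proof.
move=> ji skl xij yij.
have e0 : map_mx intr (eta i) != 0 :> 'rV[R]_2.
  apply/eqP => e0; have := eta_neq0 i => /eqP; apply.
  by apply: (@map_intr_inj R 2); rewrite e0; apply/rowP => a; rewrite !mxE.
have [|t tE] := @cross_eq0 R (map_mx intr (eta i)) (map_mx intr (eta k - eta l)) e0.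
  rewrite cross_real; have -> : cross (eta i) (eta k - eta l) = slope i k - slope i l.
    by rewrite /slope /cross !mxE; ring.
  by rewrite skl subrr.
have tc a : (eta k 0 a)%:~R - (eta l 0 a)%:~R = t * (eta i 0 a)%:~R :> R.
  by have := congr1 (fun M : 'rV[R]_2 => M 0 a) tE; rewrite !mxE rmorphB.
have iv : pairing (eta i) (x - y) = 0.
  by rewrite -ineq_sub (midline_value ji xij yij) subrr.
suff : (ineq k x - ineq k y) - (ineq l x - ineq l y) = 0 by lra.
rewrite !ineq_sub; transitivity (t * pairing (eta i) (x - y)); last by rewrite iv mulr0.
rewrite !pairing2; move: (x - y) => v.
transitivity (((eta k 0 0)%:~R - (eta l 0 0)%:~R) * v 0 0
  + ((eta k 0 1)%:~R - (eta l 0 1)%:~R) * v 0 1); first by ring.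
by rewrite !tc; ring.
Qed.

Lemma doubled_min i j k l x : doubled i j k l x -> forall r, ineq i x <= ineq r x.
Proof.
move=> [ji _ _ _ [xij xik _ kmin]] r.
have [->//|ri] := eqVneq r i; have [->|rj] := eqVneq r j; first by rewrite xij.
exact: le_trans xik (kmin r ri rj).
Qed.

(** By minimality of [k], the facet of slope one dominating it is not smaller,
    which forces the slope of [k] to be one. *)
Lemma doubled_slope_pos i j k l x : D x -> doubled i j k l x -> ineq i x < ineq k x ->
  0 < slope i k -> slope i k = 1.
Proof.
move=> Dx dx lt sk; have xmin := doubled_min dx.
have [ji [ki kj _ _] _ _ [xij xik _ kmin]] := dx.
have [h [sh hle]] := slope_one_below ji Dx xij xmin sk.
have hi : h != i by apply: contra_eq_neq sh => ->; rewrite slope_self.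
have hj : h != j by apply: contra_eq_neq sh => ->; rewrite (slope_opp ji).
have kh := kmin h hi hj.
apply/eqP; rewrite eq_le; apply/andP; split; last by [].
rewrite leNgt; apply/negP => s1.
have s1R : 0 < (slope i k)%:~R - 1 :> R by rewrite subr_gt0 -[1]/(1%:~R) ltr_int.
have : 0 < ((slope i k)%:~R - 1) * (ineq h x - ineq i x).
  by rewrite mulr_gt0 // subr_gt0; exact: lt_le_trans lt kh.
by move=> pos; have := lt_le_trans pos hle; rewrite subr_gt0 ltNge kh.
Qed.

Lemma doubled_slope i j k l x : D x -> doubled i j k l x -> ineq i x < ineq k x ->
  slope i k = 1 \/ slope i k = -1.
Proof.
move=> Dx dx lt; have [ji [ki kj _ _] _ _ [xij xik _ kmin]] := dx.
have [s0|s0|s0] := ltgtP 0 (slope i k).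
- by left; exact: doubled_slope_pos dx lt s0.
- right; have := doubled_slope_pos Dx (doubled_swap dx); rewrite -xij lt (slopeN _ ji) => /(_ isT).
  by rewrite oppr_gt0 => /(_ s0) <-; rewrite opprK.
- by have := slope_neq0 ji ki kj; rewrite -s0 eqxx.
Qed.

(** Let [r] be the smallest of the other facets at [z].  It is dominated by a
    facet whose slope is one in absolute value and of the same sign.  Facets of
    equal slope differ by a constant along the middle line, so [k] or [k'] is
    smaller still. *)
Lemma doubled_between_opposite i j k l k' l' x y (t : R) : D x -> D y ->
  doubled i j k l x -> doubled i j k' l' y ->
  slope i k = 1 -> slope i k' = -1 -> 0 <= t <= 1 ->
  let z := (1 - t) *: x + t *: y in
  exists k2 l2, doubled i j k2 l2 z.
Proof.
move=> Dx Dy dx dy sk sk' /andP[t0 t1] z.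
have xmin := doubled_min dx; have ymin := doubled_min dy.
have [ji [ki kj li lj] kl skl [xij xik xkl kmin]] := dx.
have [_ [ki' kj' li' lj'] kl' skl' [yij yik ykl kmin']] := dy.
have zij : ineq i z = ineq j z by rewrite !ineq_between xij yij.
have xy := midline_value ji xij yij.
have zmin r : ineq i z <= ineq r z.
  rewrite !ineq_between; apply: lerD; apply: ler_wpM2l => //; lra.
have Dz : D z.
  rewrite (polyhedronE geom) => r; apply: le_trans (zmin r).
  by apply/ltW/(opposite_gt0 ji zij).
have kok : (k != i) && (k != j) by rewrite ki.
case: (@Order.TotalTheory.arg_minP _ _ _ k (fun r => (r != i) && (r != j)) (fun r => ineq r z) kok)
  => r /andP[ri rj] rmin.
have {}rmin s : s != i -> s != j -> ineq r z <= ineq s z.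
  by move=> si sj; apply: rmin; rewrite si.
(* A facet of slope one below r at z, compared with a facet of slope one that
   is minimal at some point of the middle line. *)
have below (a b c d : I0) u : eta b = - eta a -> ineq a u = ineq b u -> ineq a z = ineq b z ->
    (forall s : I0, ineq a z <= ineq s z) -> c != a -> c != b ->
    (forall s : I0, s != a -> s != b -> ineq c u <= ineq s u) -> slope a c = 1 ->
    slope a c = slope a d -> ineq c u = ineq d u -> 0 < slope a r ->
    ineq c z <= ineq r z /\ ineq c z = ineq d z.
  move=> ba uab zab zmina ca cb cmin sc scd ucd sr.
  have [h [sh hle]] := slope_one_below ba Dz zab zmina sr.
  have ha : h != a by apply: contra_eq_neq sh => ->; rewrite slope_self.
  have hb : h != b by apply: contra_eq_neq sh => ->; rewrite (slope_opp ba).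
  have hr : ineq h z <= ineq r z.
    rewrite -subr_ge0; apply: le_trans hle; rewrite mulr_ge0 ?subr_ge0 //.
    by rewrite -[1]/(1%:~R) ler_int.
  have hc : slope a h = slope a c by rewrite sh sc.
  have := equal_slope_const ba hc uab zab; have := cmin h ha hb.
  have := equal_slope_const ba scd uab zab; split; lra.
have [sr|sr|sr] := ltgtP 0 (slope i r).
- have [cr cl] := below i j k l x ji xij zij zmin ki kj kmin sk skl xkl sr.
  exists k, l; split=> //; split=> // s si sj.
  exact: le_trans cr (rmin s si sj).
- have ij : eta i = - eta j by rewrite ji opprK.
  have [||||||||cr cl] := below j i k' l' y ij (esym yij) (esym zij).
  + by move=> s; rewrite -zij.
  + exact: kj'.
  + exact: ki'.
  + by move=> s sj si; exact: kmin'.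
  + by rewrite (slopeN _ ji) sk' opprK.
  + by rewrite !(slopeN _ ji) skl'.
  + exact: ykl.
  + by rewrite (slopeN _ ji) oppr_gt0.
  exists k', l'; split=> //; split=> // s si sj.
  exact: le_trans cr (rmin s si sj).
- by have := slope_neq0 ji ri rj; rewrite -sr eqxx.
Qed.

Lemma doubled_between i j k l k' l' x y (t : R) : D x -> D y ->
  doubled i j k l x -> ineq i x < ineq k x ->
  doubled i j k' l' y -> ineq i y < ineq k' y -> 0 <= t <= 1 ->
  exists i2 j2 k2 l2, doubled i2 j2 k2 l2 ((1 - t) *: x + t *: y).
Proof.
move=> Dx Dy dx ltx dy lty t01.
have [sE|sE] := eqVneq (slope i k) (slope i k').
  have [ji [ki kj li lj] kl skl [xij xik xkl kmin]] := dx.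
  have [_ [ki' kj' li' lj'] kl' skl' [yij yik ykl kmin']] := dy.
  have ekk := equal_slope_const ji sE xij yij; have ekl := equal_slope_const ji skl xij yij.
  have kk' := kmin k' ki' kj'; have k'k := kmin' k ki kj.
  case/andP: t01 => t0 t1; have t1' : 0 <= 1 - t by lra.
  exists i, j, k, l; split=> //; split; rewrite ?ineq_between.
  - by rewrite xij yij.
  - by apply: lerD; apply: ler_wpM2l => //; lra.
  - by congr (_ * _ + _ * _) => //; lra.
  - move=> r ri rj; rewrite ineq_between; have := kmin r ri rj; have := kmin' r ri rj => h h'.
    by apply: lerD; apply: ler_wpM2l => //; lra.
have [sk|sk] := doubled_slope Dx dx ltx; have [sk'|sk'] := doubled_slope Dy dy lty.
- by rewrite sk sk' eqxx in sE.
- have [k2 [l2 d2]] := doubled_between_opposite Dx Dy dx dy sk sk' t01.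
  by exists i, j, k2, l2.
- have [ji _ _ _ _] := dx.
  have s1 : slope j k = 1 by rewrite (slopeN _ ji) sk opprK.
  have s2 : slope j k' = -1 by rewrite (slopeN _ ji) sk'.
  have [k2 [l2 d2]] := doubled_between_opposite Dx Dy (doubled_swap dx) (doubled_swap dy) s1 s2 t01.
  by exists j, i, k2, l2.
- by rewrite sk sk' eqxx in sE.
Qed.

(** The inequalities of another pair of opposite facets are both larger than
    the smallest value, and their sum is constant on the plane.  So each of two
    distinct pairs would have larger sum than the other. *)
Lemma doubled_same_pair i j k l i' j' k' l' x y :
  doubled i j k l x -> ineq i x < ineq k x ->
  doubled i' j' k' l' y -> ineq i' y < ineq k' y ->
  (i' = i /\ j' = j) \/ (i' = j /\ j' = i).
Proof.
have closer (a b c d a' b' c' d' : I0) u v : doubled a b c d u -> ineq a u < ineq c u ->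
    doubled a' b' c' d' v -> a' != a -> a' != b -> ineq a u < ineq a' v.
  move=> [ba [_ _ _ _] _ _ [uab uac _ cmin]] lt [ba' _ _ _ [vab _ _ _]] a'a a'b.
  have b'a : b' != a.
    apply: contra a'b => /eqP b'a; apply/eqP/(geometric_conormal_inj geom).
    by rewrite ba -b'a ba' opprK.
  have b'b : b' != b.
    apply: contra a'a => /eqP b'b; apply/eqP/(geometric_conormal_inj geom)/oppr_inj.
    by rewrite -ba -ba' b'b.
  have := ineq_opp ba' u v; have := cmin a' a'a a'b; have := cmin b' b'a b'b.
  rewrite -vab; lra.
move=> dx ltx dy lty; have [ji _ _ _ _] := dx; have [ji' _ _ _ _] := dy.
have inj := geometric_conormal_inj geom.
have [e|ne] := eqVneq i' i; first by left; split=> //; apply: inj; rewrite ji ji' e.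
have [e|ne'] := eqVneq i' j.
  by right; split=> //; apply: inj; rewrite ji' e ji opprK.
exfalso; have h1 := closer _ _ _ _ _ _ _ _ _ _ dx ltx dy ne ne'.
have inj' : i != j'.
  by apply: contra ne' => /eqP e; apply/eqP/inj; rewrite ji e ji' opprK.
rewrite eq_sym in ne.
have h2 := closer _ _ _ _ _ _ _ _ _ _ dy lty dx ne inj'.
by have := lt_trans h1 h2; rewrite ltxx.
Qed.

Lemma doubled_interior i j k l x : doubled i j k l x -> interior D x.
Proof.
move=> dx; have xmin := doubled_min dx; have [ji _ _ _ [xij _ _ _]] := dx.
by apply: ineqs_gt0_interior => r; apply: lt_le_trans (opposite_gt0 ji xij) (xmin r).
Qed.

Lemma closed_doubled y v : closed [set t : R | exists q : I0 * I0 * (I0 * I0),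
  doubled q.1.1 q.1.2 q.2.1 q.2.2 (y + t *: v)].
Proof.
have closed_ineq (r s : I0) : closed [set t : R | ineq r (y + t *: v) <= ineq s (y + t *: v)].
  pose g (t : R) : R := ineq r y - ineq s y + t * (pairing (eta r) v - pairing (eta s) v).
  rewrite (_ : [set t | _] = g @^-1` [set z | z <= 0]); last first.
    by apply/seteqP; split=> t /=; rewrite /g !ineq_line; lra.
  apply: preimage_closed; last exact: closed_le.
  move=> t _; apply: cvgD; first exact: cvg_cst.
  by apply: cvgM; [exact: cvg_id|exact: cvg_cst].
have closed_eqn (r s : I0) : closed [set t : R | ineq r (y + t *: v) = ineq s (y + t *: v)].
  rewrite (_ : [set t | _] = [set t | ineq r (y + t *: v) <= ineq s (y + t *: v)] `&`
     [set t | ineq s (y + t *: v) <= ineq r (y + t *: v)]); first exact: closedI.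
  apply/seteqP; split=> t /= => [->//|[h1 h2]].
  by apply/eqP; rewrite eq_le h1 h2.
rewrite (_ : [set t | _] = \bigcup_(q in setT)
   [set t | doubled q.1.1 q.1.2 q.2.1 q.2.2 (y + t *: v)]); last first.
  by apply/seteqP; split=> t => [[q h]|[q _ h]]; exists q.
apply: closed_bigcup => [|[[i j] [k l]] _ /=]; first exact: finite_finset.
have [cst|ncst] := pselect [/\ eta j = - eta i, [/\ k != i, k != j, l != i & l != j],
    k != l & slope i k = slope i l]; last first.
  rewrite (_ : [set t | _] = set0); first exact: closed0.
  by apply/seteqP; split=> t // [h1 h2 h3 h4 _]; apply: ncst.
have [h1 h2 h3 h4] := cst.
rewrite (_ : [set t | _] = [set t | ineq i (y + t *: v) = ineq j (y + t *: v)] `&`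
  ([set t | ineq i (y + t *: v) <= ineq k (y + t *: v)] `&`
  ([set t | ineq k (y + t *: v) = ineq l (y + t *: v)] `&`
  \bigcap_(r in [set r | r != i /\ r != j]) [set t | ineq k (y + t *: v) <= ineq r (y + t *: v)]))).
  by do 3 (apply: closedI => //); apply: closed_bigI => r _.
apply/seteqP; split=> t /=.
  by move=> [_ _ _ _ [e1 e2 e3 e4]]; do 3 (split=> //); move=> r [ri rj]; exact: e4.
by move=> [e1 [e2 [e3 e4]]]; split=> //; split=> // r ri rj; exact: e4.
Qed.

(** The nonexceptional critical points lie on one line, and the segment between
    any two of them consists of critical points; so does the closure of their
    convex hull, because [doubled] is a closed condition. *)
Lemma polygon_critical_set : exists A S : set 'rV[R]_2,
  [/\ finite_set A, S = set0 \/ (exists a b, a != b /\ S = line_segment a b)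
    & [set x | interior D x /\ critical x] = A `|` S].
Proof.
pose X := [set x | interior D x /\ critical x].
pose A0 := X `&` [set x | exceptional x].
have finA0 : finite_set A0 by apply: sub_finite_set finite_exceptional => x [].
have [[y [Xy ney]]|nX'] := pselect (exists y, X y /\ ~ exceptional y); last first.
  exists A0, set0; split=> //; first by left.
  rewrite setU0; apply/seteqP; split=> x [] // Xx crit; split=> //.
  by apply: contrapT => ne; apply: nX'; exists x.
have [i [j [k [l [dy lty]]]]] := critical_doubled Xy.2 ney.
have [ji _ _ _ [yij _ _ _]] := dy.
have [v v0] : exists v : 'rV[R]_2, v = perp (map_mx intr (eta i)) by eexists.
have vn0 : v != 0.
  apply/eqP => p0; have /eqP := eta_neq0 i; apply; rewrite v0 in p0.
  apply: rowP2; rewrite mxE; apply: (@intr_inj R).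
    by have := congr1 (fun M : 'rV[R]_2 => M 0 1) p0; rewrite perp1 !mxE.
  have := congr1 (fun M : 'rV[R]_2 => M 0 0) p0; rewrite perp0 !mxE => /eqP.
  by rewrite oppr_eq0 => /eqP.
pose g t := y + t *: v.
pose T := [set t | X (g t) /\ ~ exceptional (g t)].
pose C := [set t : R | exists q : I0 * I0 * (I0 * I0), doubled q.1.1 q.1.2 q.2.1 q.2.2 (g t)].
(* All nonexceptional points lie on the middle line of the facets i and j. *)
have same x : X x -> ~ exceptional x -> exists k' l', doubled i j k' l' x /\ ineq i x < ineq k' x.
  move=> Xx nex; have [a [b [c [d [dx ltx]]]]] := critical_doubled Xx.2 nex.
  have [[ai bj]|[aj bi]] := doubled_same_pair dy lty dx ltx.
    by exists c, d; rewrite -ai -bj.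
  exists c, d; split; first by rewrite -aj -bi; exact: doubled_swap.
  by have [_ _ _ _ [xab _ _ _]] := dx; rewrite -bi -xab.
have onT x : X x -> ~ exceptional x -> exists2 t, T t & x = g t.
  move=> Xx nex; have [k' [l' [dx _]]] := same x Xx nex.
  have [_ _ _ _ [xij _ _ _]] := dx.
  have [|t tE] := @cross_eq0 R v (x - y) vn0.
    have -> : cross v (x - y) = - pairing (eta i) (x - y).
      by rewrite pairing2 /cross v0 perp0 perp1 !mxE; ring.
    by rewrite -ineq_sub (midline_value ji xij yij) subrr oppr0.
  have xE : x = g t by rewrite /g -tE addrC subrK.
  by exists t => //; rewrite /T /= -xE.
have [B yB] := polygon_bounded.
have [a va] : exists a : 'I_2, v 0 a != 0 by have [] := row2_neq0 vn0; [exists 0|exists 1].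
have TB t : T t -> `|t| <= (B + B) / `|v 0 a|.
  move=> [[intt _] _]; rewrite ler_pdivlMr ?normr_gt0 // -normrM.
  have -> : t * v 0 a = g t 0 a - y 0 a by rewrite !mxE; ring.
  apply: le_trans (ler_normB _ _) _.
  by apply: lerD; apply: yB; apply: interior_subset => //; case: Xy.
have T0 : T 0 by rewrite /T /= /g scale0r addr0.
have between t1 t2 t : T t1 -> T t2 -> t1 <= t <= t2 -> C t.
  move=> [X1 ne1] [X2 ne2] t12.
  have [k1 [l1 [d1 lt1]]] := same _ X1 ne1; have [k2 [l2 [d2 lt2]]] := same _ X2 ne2.
  have [s [s01 gE]] : exists s, 0 <= s <= 1 /\ g t = (1 - s) *: g t1 + s *: g t2.
    have [t12e|t12n] := eqVneq t1 t2.
      have <- : t1 = t.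
        by have [h1 h2] := andP t12; apply/eqP; rewrite eq_le h1 t12e h2.
      by exists 0; rewrite lexx ler01 subr0 scale1r scale0r addr0.
    have [h1 h2] := andP t12.
    have pos : 0 < t2 - t1 by rewrite subr_gt0 lt_neqAle t12n (le_trans h1).
    exists ((t - t1) / (t2 - t1)); split.
      apply/andP; split; first by apply: divr_ge0; lra.
      by rewrite ler_pdivrMr // mul1r; lra.
    have nz : t2 - t1 != 0 by rewrite gt_eqF.
    by apply: rowP2; rewrite !mxE; field.
  have [i3 [j3 [k3 [l3 d3]]]] := doubled_between (interior_subset X1.1)
    (interior_subset X2.1) d1 lt1 d2 lt2 s01.
  by exists (i3, j3, (k3, l3)); rewrite gE.
have [|p [q [Tpq pq Cpq]]] := closed_hull (@closed_doubled y v) _ TB between.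
  by exists 0.
have CX t : C t -> X (g t).
  by move=> [[[i3 j3] [k3 l3]] d3]; split; [exact: doubled_interior d3|exact: doubled_critical d3].
have [pqe|pqn] := eqVneq p q.
  exists (A0 `|` [set g p]), set0; split; first by rewrite finite_setU.
    by left.
  rewrite setU0; apply/seteqP; split=> x => [Xx|].
    have [ex|nex] := pselect (exceptional x); first by left.
    right; have [t Tt ->] := onT x Xx nex; congr g.
    by have := Tpq t Tt; rewrite -pqe => /andP[h1 h2]; apply/eqP; rewrite eq_le h1 h2.
  by move=> [[]//|->]; apply/CX/Cpq; rewrite lexx.
exists A0, (line_segment (g p) (g q)); split=> //.
  right; exists (g p), (g q); split=> //.
  apply: contra pqn => /eqP /addrI /eqP; rewrite -subr_eq0 -scalerBl scaler_eq0 (negbTE vn0) orbF.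
  by rewrite subr_eq0.
apply/seteqP; split=> x => [Xx|].
  have [ex|nex] := pselect (exceptional x); first by left.
  right; have [t Tt ->] := onT x Xx nex.
  have [h1 h2] := andP (Tpq t Tt).
  have pos : 0 < q - p by rewrite subr_gt0 lt_neqAle pqn.
  exists ((t - p) / (q - p)).
    apply/andP; split; first by apply: divr_ge0; lra.
    by rewrite ler_pdivrMr // mul1r; lra.
  have nz : q - p != 0 by rewrite gt_eqF.
  by apply: rowP2; rewrite !mxE; field.
move=> [[]//|[t /= /andP[t0 t1] <-]].
have -> : (1 - t) *: g p + t *: g q = g ((1 - t) * p + t * q).
  by apply: rowP2; rewrite !mxE; ring.
apply/CX/Cpq; have h1 : 0 <= t * (q - p) by rewrite mulr_ge0 ?subr_ge0.
have h2 : 0 <= (1 - t) * (q - p) by rewrite mulr_ge0 ?subr_ge0.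
by apply/andP; split; lra.
Qed.

End Polygon.

Theorem proposition4p1p4 (R : realType) (n : nat) (Delta : set 'rV[R]_n)
    (Delta_smooth : smooth_polytope Delta) :
  (compact Delta -> n = 2%N ->
     exists A S : set 'rV[R]_n,
       [/\ finite_set A,
           S = set0 \/ (exists a b, a != b /\ S = line_segment a b)
         & [set x | nontrivial_qW Delta x] = A `|` S]) /\
  (forall P P' : ineqs R n,
     presentation Delta P -> presentation Delta P' -> subpresentation P P' ->
     [set u | interior Delta u /\ has_critical_point P u] =
     [set u | interior Delta u /\ has_critical_point P' u]).
Proof.
have [P0 geom smooth] := Delta_smooth; split=> [cDelta n2|P P' presP presP' _].
  subst n; have [[x0 int_x0]|empty] := pselect (exists x, interior Delta x); last first.
    exists set0, set0; split; [exact: finite_set0|by left|].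
    rewrite setU0; apply/seteqP; split=> x // [intx _].
    by apply: empty; exists x.
  have [A [S [finA S_segment AS]]] := polygon_critical_set geom smooth cDelta int_x0.
  exists A, S; split=> //; rewrite -AS; apply/seteqP; split=> x.
    move=> [intx [P presP crit]]; split=> //.
    exact/(has_critical_point_presentation geom smooth presP intx).
  move=> [intx crit]; split=> //; exists P0; first exact: geom.1.
  exact/(has_critical_point_presentation geom smooth geom.1 intx).
apply/seteqP; split=> u [intu]; move=> /(has_critical_point_presentation geom smooth _ intu) crit.
  split=> //; apply/(has_critical_point_presentation geom smooth presP' intu).
  exact: crit.
split=> //; apply/(has_critical_point_presentation geom smooth presP intu).
exact: crit.
Qed.
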